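(* There exists a universal explicit real constant $C_{BW}$ such that the following holds. Let $a<b$ and let $\mu$ be a Borel probability measure on $[a,b]$ with density $$\frac{d\mu}{dx}(t)=\frac{g(t)}{\pi\sqrt{(t-a)(b-t)}},$$ where $g$ is non-negative, concave and increasing on $(a,b)$ and $t\mapsto\frac{g(t)}{t-a}$ is convex on $(a,b)$. Then for each integer $k\ge2$ there is a monic polynomial $P_k$ of degree $k$ such that (a) for all $z\in\mathbb C$: $\ \log|P_k(z)|+k\,U^\mu(z)\le C_{BW}$; (b) for all $x\in\mathbb R\setminus(a,b)$: $\ \log|P_k(x)|+k\,U^\mu(x)\ge0$.
   Context: $U^\mu(z)=\int\log\frac1{|z-t|}\,d\mu(t)$ is the logarithmic potential of $\mu$. ''Increasing'' is meant in the non-strict sense. ''Universal'' means independent of $a,b,\mu,g$ and $k$. *)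

(* Defs.v *)
From HB Require Import structures.
From mathcomp Require Import all_boot all_order all_algebra.
From mathcomp Require Import all_classical all_reals all_analysis.
From mathcomp Require Import complex.

Set Implicit Arguments.
Unset Strict Implicit.
Unset Printing Implicit Defensive.

Import Order.TTheory GRing.Theory Num.Theory.
Import numFieldNormedType.Exports.

Local Open Scope classical_set_scope.
Local Open Scope ring_scope.
Local Open Scope complex_scope.

Section LogPotential.
Context {R : realType}.

(* The library norm on [R[i]] takes its values in [R[i]]; [normc] is the same
   modulus, valued in [R]. *)
Definition cabs (z : R[i]) : R := ComplexField.Normc.normc z.

(* Extended-real valued: [lne 0 = -oo], and the inverse is taken in [\bar R],
   where [0^-1 = +oo], so that the integrand is [+oo] at [t = z]. *)
Definition log_potential (mu : probability (measurableTypeR R) R) (z : R[i]) :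
    \bar R :=
  (\int[mu]_t lne ((cabs (z - (t : R)%:C))%:E^-1))%E.

(* [mu] is carried by the open interval [(a, b)] and has there the density [f]
   with respect to Lebesgue measure. *)
Definition has_density_on (mu : probability (measurableTypeR R) R) (a b : R)
    (f : R -> R) : Prop :=
  forall A : set (measurableTypeR R), measurable A ->
    mu A = (\int[lebesgue_measure]_(t in A `&` [set` `]a, b[]) (f t)%:E)%E.

Definition concave_function (D : set R) (f : R -> R) : Prop :=
  convex_function (E := R^o) D (fun t => - f t).

End LogPotential.

(* Main.v *)
(* Only the monotonicity and the concavity of [g] matter: they make [g] doubling
   from the left endpoint, so that [mu ]u, v]] is, up to universal factors,
   [g m * (v - u) / sqrt ((v - a) * (b - u))] with [m] the midpoint of [u, v].
   Hence, for intervals [S] inside [I] inside [[a, b]], the ratio [mu S / mu I]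
   lies between universal multiples of [(|S|/|I|)^(3/2)] and [(|S|/|I|)^(1/2)].
   Cut [[a, b]] into [k] intervals of mass [1/k] and put the zeros of [P] at
   their barycenters. On the real line outside [(a, b)], [t |-> ln |x - t|] is
   concave and (b) is Jensen's inequality. For (a), the interval [I] with
   barycenter [c] contributes at most a constant times
   [min 1 (|I| / |Re z - c|)^2]: near [I] by the upper bound on the ratio, which
   controls the logarithmic singularity, and away from [I] because the first
   order Taylor term has mean zero. By the lower bound on the ratio this is
   [O(n^(-4/3))] when [I] is the [n]-th interval away from [Re z], which is
   summable. *)

Require Import Defs.
From HB Require Import structures.
From mathcomp Require Import all_boot all_order all_algebra.
From mathcomp Require Import all_classical all_reals all_analysis.
From mathcomp Require Import complex.
From mathcomp Require Import measurable_realfun.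
From mathcomp Require Import zify ring lra.

Set Implicit Arguments.
Unset Strict Implicit.
Unset Printing Implicit Defensive.

Import Order.TTheory GRing.Theory Num.Theory.
Import numFieldNormedType.Exports.

Local Open Scope classical_set_scope.
Local Open Scope ring_scope.
Local Open Scope complex_scope.

(** * Mass of an interval *)

Section ArcsineIntegral.
Context {R : realType}.
Implicit Types a b u v t : R.

Lemma sqrtB_le (x y : R) : 0 < y -> 0 <= x <= y ->
  Num.sqrt y - Num.sqrt x <= (y - x) / Num.sqrt y.
Proof.
move=> y0 /andP[x0 xy]; rewrite ler_pdivlMr ?sqrtr_gt0//.
have xX := sqr_sqrtr x0; have yY := sqr_sqrtr (ltW y0).
have XY : Num.sqrt x <= Num.sqrt y by exact: ler_wsqrtr.
have X0 := sqrtr_ge0 x; move: XY X0 xX yY.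
move: (Num.sqrt x) (Num.sqrt y) => X Y XY X0 <- <-.
by nra.
Qed.

Lemma is_derive_sqrtB a t : a < t ->
  is_derive t 1 (fun s => Num.sqrt (s - a)) (2 * Num.sqrt (t - a))^-1.
Proof.
move=> at_; have h : 0 < t - a by rewrite subr_gt0.
apply: (is_derive_eq (is_derive1_comp (f := Num.sqrt) (g := fun s => s - a)
  (is_derive1_sqrt h) _)).
by rewrite subr0 mulr1.
Qed.

Lemma is_derive_sqrtBl b t : t < b ->
  is_derive t 1 (fun s => Num.sqrt (b - s)) (- (2 * Num.sqrt (b - t))^-1).
Proof.
move=> tb; have h : 0 < b - t by rewrite subr_gt0.
apply: (is_derive_eq (is_derive1_comp (f := Num.sqrt) (g := fun s => b - s)
  (is_derive1_sqrt h) _)).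
by rewrite add0r mul1r mulrN1.
Qed.

Lemma continuous_arcsine_density a b t : a < t < b ->
  {for t, continuous (fun s => (Num.sqrt ((s - a) * (b - s)))^-1)}.
Proof.
move=> /andP[at_ tb].
apply: cvgV; first by rewrite gt_eqF// sqrtr_gt0 mulr_gt0// subr_gt0.
apply: continuous_comp; last exact: sqrt_continuous.
by apply: cvgM; apply: cvgB; by [exact: cvg_cst|exact: cvg_id].
Qed.

(* [1/sqrt(XY) = (sqrt(X/Y) + sqrt(Y/X))/(X+Y)], where the numerators are
   largest at the endpoints of [[u, v]]. *)
Lemma arcsine_density_le a b u v t : a <= u -> u <= t -> t <= v -> v <= b ->
  a < t < b ->
  (Num.sqrt ((t - a) * (b - t)))^-1 <=
  (Num.sqrt (v - a) / Num.sqrt (b - t) + Num.sqrt (b - u) / Num.sqrt (t - a))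
  / (b - a).
Proof.
move=> au ut tv vb /andP[at_ tb].
have X0 : 0 < Num.sqrt (t - a) by rewrite sqrtr_gt0 subr_gt0.
have Y0 : 0 < Num.sqrt (b - t) by rewrite sqrtr_gt0 subr_gt0.
rewrite sqrtrM; last by rewrite subr_ge0 ltW.
have hx : Num.sqrt (t - a) ^+ 2 = t - a by rewrite sqr_sqrtr// subr_ge0 ltW.
have hy : Num.sqrt (b - t) ^+ 2 = b - t by rewrite sqr_sqrtr// subr_ge0 ltW.
have lx : Num.sqrt (t - a) <= Num.sqrt (v - a) by rewrite ler_wsqrtr// lerB.
have ly : Num.sqrt (b - t) <= Num.sqrt (b - u) by rewrite ler_wsqrtr// lerB.
have -> : b - a = Num.sqrt (t - a) ^+ 2 + Num.sqrt (b - t) ^+ 2.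
  by rewrite hx hy; ring.
move: X0 Y0 lx ly; move: (Num.sqrt (t - a)) (Num.sqrt (b - t)) => X Y.
move: (Num.sqrt (v - a)) (Num.sqrt (b - u)) => V U X0 Y0 lx ly.
rewrite ler_pdivlMr ?addr_gt0 ?exprn_gt0//.
rewrite -(ler_pM2r (mulr_gt0 X0 Y0)).
rewrite [leLHS](_ : _ = X ^+ 2 + Y ^+ 2); last by field; rewrite !gt_eqF.
rewrite [leRHS](_ : _ = V * X + U * Y); last by field; rewrite !gt_eqF.
by nra.
Qed.

(** The majorant of [arcsine_density_le] has an explicit primitive, whose increment over the larger
    interval [u, v] is bounded by [sqrtB_le]. The gaps between u and u' and between v' and v keep
    the integration away from the singularities at a and b. *)
Lemma arcsine_integral_le a b u v u' v' :
  a <= u -> u < u' -> u' < v' -> v' < v -> v <= b ->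
  (\int[lebesgue_measure]_(t in `[u', v'])
     ((Num.sqrt ((t - a) * (b - t)))^-1)%:E <=
   (4 * (v - u) / Num.sqrt ((v - a) * (b - u)))%:E)%E.
Proof.
move=> au uu' uv' vv' vb.
pose V : R := Num.sqrt (v - a); pose U : R := Num.sqrt (b - u).
have va0 : 0 < v - a by lra.
have bu0 : 0 < b - u by lra.
have V0 : 0 < V by rewrite sqrtr_gt0.
have U0 : 0 < U by rewrite sqrtr_gt0.
have ba0 : 0 < b - a by lra.
pose h t : R := (V / Num.sqrt (b - t) + U / Num.sqrt (t - a)) / (b - a).
pose F t : R := 2 / (b - a) * (U * Num.sqrt (t - a) - V * Num.sqrt (b - t)).
have dF t : a < t < b -> is_derive t 1 F (h t).
  move=> /andP[at_ tb].
  have d1 := is_derive_sqrtB at_; have d2 := is_derive_sqrtBl tb.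
  apply: (is_derive_eq (is_deriveZ (2 / (b - a))
    (is_deriveB (is_deriveZ U d1) (is_deriveZ V d2)))).
  have : 0 < Num.sqrt (t - a) by rewrite sqrtr_gt0 subr_gt0.
  have : 0 < Num.sqrt (b - t) by rewrite sqrtr_gt0 subr_gt0.
  rewrite /h /= /GRing.scale /=.
  move: (Num.sqrt (t - a)) (Num.sqrt (b - t)) => X Y Y0 X0.
  by field; rewrite !gt_eqF.
have cF t : a < t < b -> {for t, continuous F}.
  move=> /dF d; apply: differentiable_continuous; apply/derivable1_diffP.
  exact: ex_derive.
have ch t : a < t < b -> {for t, continuous h}.
  move=> /andP[at_ tb]; apply: cvgMl; apply: cvgD.
    apply: cvgMr; apply: cvgV; first by rewrite gt_eqF// sqrtr_gt0 subr_gt0.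
    apply: continuous_comp; last exact: sqrt_continuous.
    by apply: cvgB; [exact: cvg_cst|exact: cvg_id].
  apply: cvgMr; apply: cvgV; first by rewrite gt_eqF// sqrtr_gt0 subr_gt0.
  apply: continuous_comp; last exact: sqrt_continuous.
  by apply: cvgB; [exact: cvg_id|exact: cvg_cst].
have cw (k : R -> R) : (forall t, a < t < b -> {for t, continuous k}) ->
    {within `[u', v'], continuous k}.
  move=> ck; apply: continuous_in_subspaceT => t /set_mem.
  by rewrite /= in_itv/= => tI; apply: ck; lra.
have mw (k : R -> R) : (forall t, a < t < b -> {for t, continuous k}) ->
    measurable_fun `[u', v'] k.
  move=> ck.
  by apply: subspace_continuous_measurable_fun => //; exact: cw.
apply: (@le_trans _ _ (\int[lebesgue_measure]_(t in `[u', v']) (h t)%:E)%E).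
  apply: ge0_le_integral => //=.
  - by apply/measurable_EFinP; exact: (mw _ (@continuous_arcsine_density a b)).
  - by apply/measurable_EFinP; exact: mw.
  - move=> t; rewrite in_itv/= => /andP[ut tv]; rewrite lee_fin.
    by apply: arcsine_density_le => //; lra.
rewrite (@continuous_FTC2 _ h F)//; last first.
- move=> t; rewrite in_itv/= => tI; rewrite derive1E.
  by have [_ ->] : is_derive t 1 F (h t) by apply: dF; lra.
- have [_ ? ?] := (continuous_within_itvP _ uv').1 (cw _ cF).
  split => // t; rewrite in_itv/= => tI.
  by have [] : is_derive t 1 F (h t) by apply: dF; lra.
- exact: cw.
rewrite -EFinB lee_fin.
have leF : F v' - F u' <= F v - F u.
  have s1 : Num.sqrt (v' - a) <= V by apply: ler_wsqrtr; lra.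
  have s2 : Num.sqrt (u - a) <= Num.sqrt (u' - a) by apply: ler_wsqrtr; lra.
  have s3 : Num.sqrt (b - v) <= Num.sqrt (b - v') by apply: ler_wsqrtr; lra.
  have s4 : Num.sqrt (b - u') <= U by apply: ler_wsqrtr; lra.
  rewrite /F -!mulrBr; apply: ler_wpM2l; first by rewrite divr_ge0 ?ltW.
  rewrite opprB !addrA -/V -/U.
  have := ler_wpM2l (ltW U0) s1; have := ler_wpM2l (ltW U0) s2.
  have := ler_wpM2l (ltW V0) s3; have := ler_wpM2l (ltW V0) s4.
  lra.
apply: (le_trans leF).
have e1 : V - Num.sqrt (u - a) <= (v - u) / V.
  have -> : v - u = (v - a) - (u - a) by ring.
  by apply: sqrtB_le => //; lra.
have e2 : U - Num.sqrt (b - v) <= (v - u) / U.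
  have -> : v - u = (b - u) - (b - v) by ring.
  by apply: sqrtB_le => //; lra.
have VV : V ^+ 2 = v - a by rewrite sqr_sqrtr// ltW.
have UU : U ^+ 2 = b - u by rewrite sqr_sqrtr// ltW.
have -> : F v - F u =
    2 / (b - a) * (U * (V - Num.sqrt (u - a)) + V * (U - Num.sqrt (b - v))).
  by rewrite /F -/V -/U; ring.
apply: (@le_trans _ _ (2 / (b - a) * (U * ((v - u) / V) + V * ((v - u) / U)))).
  apply: ler_wpM2l; first by rewrite divr_ge0 ?ltW.
  by apply: lerD; apply: ler_wpM2l => //; exact: ltW.
rewrite sqrtrM ?(ltW va0)// -/V -/U.
have -> : 2 / (b - a) * (U * ((v - u) / V) + V * ((v - u) / U)) =
    2 * (v - u) * ((v - a) + (b - u)) / ((b - a) * (V * U)).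
  by rewrite -VV -UU; field; rewrite !gt_eqF.
rewrite ler_pdivrMr ?mulr_gt0//.
have -> : 4 * (v - u) / (V * U) * ((b - a) * (V * U)) =
  2 * (v - u) * (2 * (b - a)) by field; rewrite !gt_eqF.
(* What remains is (v - a) + (b - u) = (b - a) + (v - u) <= 2 * (b - a). *)
by apply: ler_wpM2l; nra.
Qed.
End ArcsineIntegral.

(** * Open intervals by exhaustion from inside *)

Lemma measure_nondecreasing_bigcup_le d (T : measurableType d) (R : realType)
    (nu : {measure set T -> \bar R}) (F : (set T)^nat) (M : \bar R) :
  (forall n, measurable (F n)) -> nondecreasing_seq F ->
  (forall n, (nu (F n) <= M)%E) -> (nu (\bigcup_n F n) <= M)%E.
Proof.
move=> mF ndF leM.
have cv := nondecreasing_cvg_mu (mu := nu) mF (bigcupT_measurable _ mF) ndF.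
rewrite -(cvg_lim _ cv)//; apply: lime_le; first by apply/cvg_ex; eexists; exact: cv.
by apply: nearW => n; exact: leM.
Qed.

Section OpenInterval.
Context {R : realType} (nu : {measure set (measurableTypeR R) -> \bar R}).

(** Continuity from below is applied twice, first at the left endpoint with v' fixed, then at the
    right one. Empty intervals are covered by 0 <= M. *)
Lemma measure_itv_oo_le (u v : R) (M : \bar R) :
  (0 <= M)%E ->
  (forall u' v' : R, u < u' -> u' < v' -> v' < v -> (nu `[u', v']%classic <= M)%E) ->
  (nu `]u, v[%classic <= M)%E.
Proof.
move=> M0 leM.
have inv_le n m : (n <= m)%N -> m.+1%:R^-1 <= n.+1%:R^-1 :> R.
  by move=> nm; rewrite lef_pV2 ?posrE ?ltr0n// ler_nat.
have inv_gt n : 0 < n.+1%:R^-1 :> R by rewrite invr_gt0 ltr0n.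
have leM2 v' : v' < v -> (nu `]u, v']%classic <= M)%E.
  move=> vv'; rewrite itv_open_bnd_bigcup.
  apply: measure_nondecreasing_bigcup_le => [n|m n nm|n]//.
    by rewrite subsetEset; apply: subset_itvr; rewrite bnd_simp lerD2l inv_le.
  have : u < u + n.+1%:R^-1 by rewrite ltrDl.
  move: (u + n.+1%:R^-1) => c uc; have [cv|vc] := leP c v'; last first.
    by rewrite set_itv_ge ?measure0// bnd_simp -ltNge.
  (* If c = v' the interval is a single point, so it is enlarged to one with distinct endpoints. *)
  apply: (@le_trans _ _ (nu `[c, (v' + v) / 2]%classic)).
    apply: le_measure; rewrite ?inE//.
    by apply: subset_itvl; rewrite bnd_simp; lra.
  by apply: leM => //; lra.
rewrite itv_bnd_open_bigcup.
apply: measure_nondecreasing_bigcup_le => [n|m n nm|n]//.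
  by rewrite subsetEset; apply: subset_itvl; rewrite bnd_simp lerD2l lerN2 inv_le.
by apply: leM2; rewrite ltrBlDr ltrDl.
Qed.

End OpenInterval.

(** Half-open intervals make the masses of adjacent intervals add up exactly. *)
Definition mass (R : realType) (mu : probability (measurableTypeR R) R)
  (u v : R) : R := fine (mu `]u, v]%classic).

(** * Two-sided bounds for the mass of an interval *)

Section DensityBounds.
Context {R : realType} (a b : R) (g : R -> R).

(** The point s is a convex combination of t and s' = (a + s) / 2, and the non-negative term with g
    s' is dropped. Since g is controlled only inside the open interval, s' replaces a, which costs
    the factor 2. *)
Lemma concave_ge0_doubling s t :
  concave_function [set` `]a, b[] g -> {in `]a, b[, forall t, 0 <= g t} ->
  a < s -> s <= t -> t < b -> (s - a) * g t <= 2 * (t - a) * g s.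
Proof.
move=> cg g0 as_ st tb.
have gt0 : 0 <= g t by apply: g0; rewrite in_itv/= tb (lt_le_trans as_).
pose s' := (a + s) / 2.
have h1 : 0 < t - s' by rewrite /s'; lra.
pose l := (s - s') / (t - s').
have l01 : 0 <= l <= 1.
  by apply/andP; split; [apply: divr_ge0|rewrite ler_pdivrMr// mul1r]; rewrite /s'; lra.
have g0' : 0 <= g s' by apply: g0; rewrite in_itv/= /s'; lra.
have /andP[l0 l1] := l01.
pose L : {i01 R} := Itv01 l0 l1.
have eL : (conv L (t : R^o) (s' : R^o) : R) = s.
  transitivity (l * t + (1 - l) * s') => //.
  by rewrite /l; field; rewrite gt_eqF.
have := cg L t s'; rewrite !inE/= !in_itv/= => /(_ _ _)/wrap[].
- by lra.
- by rewrite /s'; lra.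
rewrite [X in g X](eL : _ = s) convRE /= /unstable.onem => cgL.
have lg : l * g t <= g s by nra.
have ll : (t - s') * l = (s - a) / 2 by rewrite mulrC divfK ?gt_eqF// /s'; lra.
have : (t - s') * (l * g t) <= (t - a) * g s.
  apply: ler_pM => //; [by lra|by rewrite mulr_ge0|by rewrite /s'; lra].
by rewrite mulrA ll; lra.
Qed.

Hypothesis g0 : {in `]a, b[, forall t, 0 <= g t}.
Hypothesis gnd : {in `]a, b[ &, {homo g : s t / s <= t}}.
Hypothesis gdbl : forall s t, a < s -> s <= t -> t < b ->
  (s - a) * g t <= 2 * (t - a) * g s.

Let f t := g t / (pi * Num.sqrt ((t - a) * (b - t))).

(** Monotonicity turns the sets where g >= r into intervals, and the other factor is continuous. *)
Lemma measurable_arcsine_density : measurable_fun `]a, b[ f.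
Proof.
apply: measurable_funM.
  apply: (measurability (@RGenCInfty.G R)) => [|/= _ [_] [r] -> <-].
    exact: RGenCInfty.measurableE.
  apply: is_interval_measurable => s t/=.
  rewrite !in_itv/= !andbT => -[sI fs] [tI ft] w /andP[sw wt].
  have wI : a < w < b by lra.
  by split; rewrite // in_itv/= andbT (le_trans fs)// gnd ?in_itv/=.
apply: open_continuous_measurable_fun; first exact: interval_open.
move=> t; rewrite inE/= in_itv/= => /andP[at_ tb].
under eq_fun do rewrite invfM.
by apply: cvgMr; apply: continuous_arcsine_density; rewrite at_.
Qed.

Variable mu : probability (measurableTypeR R) R.
Hypothesis mu_density : has_density_on mu a b f.

Let density_ge0 t : a < t < b -> 0 <= f t.
Proof.
move=> tI; rewrite divr_ge0 ?g0 ?in_itv//.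
by rewrite mulr_ge0 ?pi_ge0 ?sqrtr_ge0.
Qed.

Lemma density_set1 t : mu [set t] = 0%E.
Proof.
rewrite mu_density; last exact: measurable_set1.
have [tI|tI] := pselect (a < t < b).
  rewrite setIidl; last by move=> _ /= ->; rewrite in_itv.
  by rewrite integral_set1.
rewrite (_ : _ `&` _ = set0) ?integral_set0//.
by apply/seteqP; split => // s [/= ->]; rewrite in_itv.
Qed.

Let kappa u v := g ((u + v) / 2) * (v - u) / Num.sqrt ((v - a) * (b - u)).

(** On the interval g <= 4 * g m: left of m by monotonicity, right of m by doubling together with t
    - a <= 2 * (m - a). The other factor 4 of the constant 16 comes from [arcsine_integral_le]. *)
Lemma density_itv_oo_le u v : a <= u -> u < v -> v <= b ->
  (mu `]u, v[%classic <= (16 / pi * kappa u v)%:E)%E.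
Proof.
move=> au uv vb; set m := (u + v) / 2.
have mI : a < m < b by rewrite /m; lra.
have gm0 : 0 <= g m by apply: g0; rewrite in_itv.
apply: measure_itv_oo_le => [|u' v' uu' uv' vv'].
  rewrite lee_fin; apply: mulr_ge0; first by rewrite divr_ge0 ?pi_ge0.
  by apply: divr_ge0; [apply: mulr_ge0; lra|exact: sqrtr_ge0].
have sub : [set` `[u', v']] `<=` [set` `]a, b[].
  by move=> t/=; rewrite !in_itv/=; lra.
have := mu_density (measurable_itv `[u', v']); rewrite setIidl// => muE.
rewrite [leLHS]muE.
pose w t := (Num.sqrt ((t - a) * (b - t)))^-1.
have w0 t : 0 <= w t by rewrite invr_ge0 sqrtr_ge0.
have mf : measurable_fun `[u', v'] (EFin \o f).
  apply/measurable_EFinP; apply: measurable_funS measurable_arcsine_density => //.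
have mw : measurable_fun `[u', v'] (EFin \o w).
  have cw : {within `[u', v'], continuous w}.
    apply: continuous_in_subspaceT => t /set_mem tI.
    by apply: continuous_arcsine_density; have := sub _ tI; rewrite /= in_itv.
  by apply/measurable_EFinP; apply: subspace_continuous_measurable_fun.
apply: (@le_trans _ _
   (\int[lebesgue_measure]_(t in `[u', v']) ((4 * g m / pi)%:E * (w t)%:E))%E).
  apply: ge0_le_integral => //=.
  - by move=> t tI; rewrite lee_fin density_ge0//; have := sub _ tI; rewrite /= in_itv.
  - by apply: measurable_funeM.
  - move=> t; rewrite in_itv/= => tI; rewrite -EFinM lee_fin.
    rewrite /f invfM mulrA -/(w t); apply: ler_wpM2r => //.
    apply: ler_wpM2r; first by rewrite invr_ge0 pi_ge0.
    have [tm|mt] := leP t m.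
      have : g t <= g m by apply: gnd => //; rewrite in_itv/=; lra.
      by lra.
    have := @gdbl m t; move=> /(_ _ _ _)/wrap[]; [lra..|] => h.
    have h2 : (t - a) <= 2 * (m - a) by rewrite /m; lra.
    by nra.
rewrite ge0_integralZl_EFin//; last 2 first.
- by move=> t _; rewrite lee_fin.
- by rewrite divr_ge0 ?pi_ge0// mulr_ge0.
have := arcsine_integral_le au uu' uv' vv' vb.
move=> /(lee_wpmul2l (x := (4 * g m / pi)%:E)) h.
apply: (le_trans (h _)); first by rewrite lee_fin divr_ge0 ?pi_ge0// mulr_ge0.
rewrite -EFinM lee_fin /kappa -/m le_eqVlt; apply/orP; left; apply/eqP.
have : 0 < Num.sqrt ((v - a) * (b - u)) by rewrite sqrtr_gt0 mulr_gt0//; lra.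
have := pi_gt0 R.
move: (Num.sqrt _) pi => S p p0 S0.
by field; rewrite !gt_eqF.
Qed.

(** Only the right half ]m, v[ is kept. There g t >= g m and (t - a) * (b - t) <= (v - a) * (b - u),
    so the density is at least the constant c; halving the length gives the 2 in the denominator. *)
Lemma density_itv_oc_ge u v : a <= u -> u < v -> v <= b ->
  ((kappa u v / (2 * pi))%:E <= mu `]u, v]%classic)%E.
Proof.
move=> au uv vb; set m := (u + v) / 2.
have mI : a < m < b by rewrite /m; lra.
have gm0 : 0 <= g m by apply: g0; rewrite in_itv.
have S0 : 0 < Num.sqrt ((v - a) * (b - u)) by rewrite sqrtr_gt0 mulr_gt0//; lra.
have p0 := pi_gt0 R.
apply: (@le_trans _ _ (mu `]m, v[%classic)); last first.
  apply: le_measure; rewrite ?inE//.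
  by apply: subset_itv; rewrite bnd_simp /m//; lra.
have sub : [set` `]m, v[] `<=` [set` `]a, b[].
  by move=> t/=; rewrite !in_itv/=; lra.
have := mu_density (measurable_itv `]m, v[); rewrite setIidl// => muE.
rewrite [leRHS]muE.
pose c := g m / (pi * Num.sqrt ((v - a) * (b - u))).
apply: (@le_trans _ _ (\int[lebesgue_measure]_(t in `]m, v[) c%:E)%E).
  rewrite integral_cst//= lebesgue_measure_itv/= lte_fin.
  rewrite (_ : m < v); last by rewrite /m; lra.
  rewrite -EFinB -EFinM lee_fin le_eqVlt; apply/orP; left; apply/eqP.
  rewrite /c /kappa -/m (_ : v - m = (v - u) / 2); last by rewrite /m; lra.
  move: p0 S0; move: (Num.sqrt _) pi => S p p0 S0.
  by field; rewrite !gt_eqF.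
apply: ge0_le_integral => //=.
- by move=> t _; rewrite lee_fin divr_ge0// mulr_ge0// ltW.
- apply/measurable_EFinP; exact: measurable_funS measurable_arcsine_density.
- move=> t; rewrite in_itv/= => tI; rewrite lee_fin.
  have tI' : a < t < b by lra.
  have gt0 : 0 <= g t by apply: g0; rewrite in_itv.
  apply: ler_pM => //.
    by rewrite invr_ge0 mulr_ge0// ltW.
    by apply: gnd; rewrite ?in_itv//=; lra.
  rewrite lef_pV2 ?posrE; last 2 first.
  - by rewrite mulr_gt0.
  - by rewrite mulr_gt0// sqrtr_gt0 mulr_gt0//; lra.
  rewrite ler_pM2l//; apply: ler_wsqrtr.
  have um : u < m by rewrite /m; lra.
  by apply: ler_pM; lra.
Qed.

Lemma mass_bounds u v : a <= u -> u < v -> v <= b ->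
  kappa u v <= 2 * (pi * mass mu u v) /\ pi * mass mu u v <= 16 * kappa u v.
Proof.
move=> au uv vb.
have p0 := pi_gt0 R.
have muE : mu `]u, v]%classic = (mass mu u v)%:E.
  by rewrite /mass fineK// fin_num_measure.
split.
  have := density_itv_oc_ge au uv vb; rewrite muE lee_fin ler_pdivrMr ?mulr_gt0//.
  by lra.
have : (mu `]u, v]%classic <= (16 / pi * kappa u v)%:E)%E.
  rewrite -(setUitv1 true) ?bnd_simp//.
  apply: (@le_trans _ _ (mu `]u, v[%classic + mu [set v])%E).
    exact: measureU2.
  by rewrite density_set1 adde0; exact: density_itv_oo_le.
rewrite muE lee_fin => h; rewrite -ler_pdivlMl//.
by rewrite mulrA [pi^-1 * _]mulrC.
Qed.

End DensityBounds.

Ltac nneg :=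
  repeat first [assumption | exact: ler0n | exact: ltW | apply: sqr_ge0
    | apply: mulr_ge0 | apply: exprn_ge0].

(** * Comparison of the masses of nested intervals *)

Section Regularity.
Context {R : realType}.

(** For S = [u, v] inside I = [p, q], these are the bounds of the mass ratio by multiples of
    (|S|/|I|)^(3/2) and (|S|/|I|)^(1/2). They are squared to avoid fractional powers and cleared of
    denominators so that degenerate intervals are allowed. *)
Definition regular_mass (K a b : R) (m : R -> R -> R) :=
  forall p u v q, a <= p -> p <= u -> u <= v -> v <= q -> q <= b ->
    (v - u) ^+ 3 * m p q ^+ 2 <= K * m u v ^+ 2 * (q - p) ^+ 3 /\
    m u v ^+ 2 * (q - p) <= K * (v - u) * m p q ^+ 2.

(** Dictionary: s = v - u, L = q - p, X = v - a, Y = q - a, Z = b - u, W = b - p; G and H are the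
    values of g at the midpoints of [u, v] and [p, q]; M and N are pi times their masses. The point
    is [key], which compares the two values of g against the square-root factors. *)
Lemma regular_lower_algebra (c s L X Y Z W G H M N : R) : 0 <= c ->
  0 < s -> 0 < L -> 0 < X -> 0 < Y -> 0 < Z -> Z <= W -> 0 <= G -> 0 <= H ->
  s * Y <= L * X -> H * X <= 4 * (G * Y) ->
  (G * s) ^+ 2 <= 4 * M ^+ 2 * (X * Z) -> N ^+ 2 * (Y * W) <= c * (H * L) ^+ 2 ->
  s ^+ 3 * N ^+ 2 <= 64 * c * M ^+ 2 * L ^+ 3.
Proof.
move=> c0 s0 L0 X0 Y0 Z0 ZW G0 H0 sY HX hM hN.
have W0 : 0 < W by exact: lt_le_trans ZW.
have d0 : 0 < Y * W * (X * Z) by rewrite !mulr_gt0.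
have HX2 : (H * X) ^+ 2 <= 16 * (G * Y) ^+ 2.
  have -> : 16 * (G * Y) ^+ 2 = (4 * (G * Y)) ^+ 2 by ring.
  by rewrite lerXn2r// ?nnegrE ?mulr_ge0// ltW.
have key : s * H ^+ 2 * (X * Z) <= 16 * G ^+ 2 * L * (Y * W).
  rewrite -(ler_pM2r X0).
  have -> : s * H ^+ 2 * (X * Z) * X = s * Z * (H * X) ^+ 2 by ring.
  apply: (@le_trans _ _ (s * Z * (16 * (G * Y) ^+ 2))).
    by apply: ler_wpM2l => //; nneg.
  have -> : s * Z * (16 * (G * Y) ^+ 2) = 16 * G ^+ 2 * Y * ((s * Y) * Z) by ring.
  have -> : 16 * G ^+ 2 * L * (Y * W) * X = 16 * G ^+ 2 * Y * ((L * X) * W) by ring.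
  apply: ler_wpM2l; first by nneg.
  by apply: ler_pM => //; nneg.
rewrite -(ler_pM2r d0).
have -> : s ^+ 3 * N ^+ 2 * (Y * W * (X * Z)) =
   s ^+ 3 * (X * Z) * (N ^+ 2 * (Y * W)) by ring.
apply: (@le_trans _ _ (s ^+ 3 * (X * Z) * (c * (H * L) ^+ 2))).
  by apply: ler_wpM2l => //; nneg.
have -> : s ^+ 3 * (X * Z) * (c * (H * L) ^+ 2) =
  c * s ^+ 2 * L ^+ 2 * (s * H ^+ 2 * (X * Z)) by ring.
apply: (@le_trans _ _ (c * s ^+ 2 * L ^+ 2 * (16 * G ^+ 2 * L * (Y * W)))).
  by apply: ler_wpM2l => //; nneg.
have -> : c * s ^+ 2 * L ^+ 2 * (16 * G ^+ 2 * L * (Y * W)) =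
  16 * c * L ^+ 3 * (Y * W) * (G * s) ^+ 2 by ring.
have -> : 64 * c * M ^+ 2 * L ^+ 3 * (Y * W * (X * Z)) =
  16 * c * L ^+ 3 * (Y * W) * (4 * M ^+ 2 * (X * Z)) by ring.
by apply: ler_wpM2l => //; nneg.
Qed.

(** The letters are those of [regular_lower_algebra]. *)
Lemma regular_upper_algebra (c s L X Y Z W G H M N : R) : 0 <= c ->
  0 < s -> 0 < L -> 0 < X -> 0 < Y -> 0 < Z -> 0 < W -> 0 <= G ->
  G <= 4 * H -> s * (Y * W) <= 2 * L * (X * Z) ->
  M ^+ 2 * (X * Z) <= c * (G * s) ^+ 2 -> (H * L) ^+ 2 <= 4 * N ^+ 2 * (Y * W) ->
  M ^+ 2 * L <= 128 * c * s * N ^+ 2.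
Proof.
move=> c0 s0 L0 X0 Y0 Z0 W0 G0 GH sYW hM hN.
have d0 : 0 < X * Z * L by rewrite !mulr_gt0.
have GH2 : G ^+ 2 <= 16 * H ^+ 2.
  have -> : 16 * H ^+ 2 = (4 * H) ^+ 2 by ring.
  by rewrite lerXn2r// nnegrE (le_trans G0).
rewrite -(ler_pM2r d0).
have -> : M ^+ 2 * L * (X * Z * L) = L ^+ 2 * (M ^+ 2 * (X * Z)) by ring.
apply: (@le_trans _ _ (L ^+ 2 * (c * (G * s) ^+ 2))).
  by apply: ler_wpM2l => //; nneg.
have -> : L ^+ 2 * (c * (G * s) ^+ 2) = c * L ^+ 2 * s ^+ 2 * G ^+ 2 by ring.
apply: (@le_trans _ _ (c * L ^+ 2 * s ^+ 2 * (16 * H ^+ 2))).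
  by apply: ler_wpM2l => //; nneg.
have -> : c * L ^+ 2 * s ^+ 2 * (16 * H ^+ 2) = 16 * c * s ^+ 2 * (H * L) ^+ 2 by ring.
apply: (@le_trans _ _ (16 * c * s ^+ 2 * (4 * N ^+ 2 * (Y * W)))).
  by apply: ler_wpM2l => //; nneg.
have -> : 16 * c * s ^+ 2 * (4 * N ^+ 2 * (Y * W)) =
  64 * c * s * N ^+ 2 * (s * (Y * W)) by ring.
have -> : 128 * c * s * N ^+ 2 * (X * Z * L) =
  64 * c * s * N ^+ 2 * (2 * L * (X * Z)) by ring.
by apply: ler_wpM2l => //; nneg.
Qed.

(** The values of g at the two midpoints are compared by monotonicity in one order of the midpoints
    and by doubling in the other; [mass_bounds] then reduces both claims to algebra. The constant is
    the larger of 64 * 16^2 and 128 * 16^2. *)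
Lemma arcsine_density_regular (a b : R) (g : R -> R)
    (mu : probability (measurableTypeR R) R) :
  has_density_on mu a b (fun t => g t / (pi * Num.sqrt ((t - a) * (b - t)))) ->
  {in `]a, b[, forall t, 0 <= g t} ->
  concave_function [set` `]a, b[] g ->
  {in `]a, b[ &, {homo g : s t / s <= t}} ->
  regular_mass (128 * 16 ^+ 2) a b (mass mu).
Proof.
move=> mud g0 cg gnd p u v q ap pu uv vq qb.
have gdbl s t := @concave_ge0_doubling R a b g s t cg g0.
have p0 := pi_gt0 R.
have [<-|uv'] := eqVneq u v.
  have -> : mass mu u u = 0.
    by rewrite /mass set_itv_ge ?measure0// bnd_simp ltxx.
  rewrite subrr.
  by rewrite !(expr0n, mulr0, mul0r).
have {uv'}uv : u < v by rewrite lt_neqAle uv'.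
have pq : p < q by lra.
have mI : a < (u + v) / 2 < b by lra.
have nI : a < (p + q) / 2 < b by lra.
have G0 : 0 <= g ((u + v) / 2) by apply: g0; rewrite in_itv.
have H0 : 0 <= g ((p + q) / 2) by apply: g0; rewrite in_itv.
have sY : (v - u) * (q - a) <= (q - p) * (v - a).
  rewrite -subr_ge0 (_ : _ - _ = (u - p) * (v - a) + (u - a) * (q - v)); last by ring.
  by rewrite addr_ge0// mulr_ge0//; lra.
have sW : (v - u) * (b - p) <= (q - p) * (b - u).
  rewrite -subr_ge0 (_ : _ - _ = (q - v) * (b - u) + (b - v) * (u - p)); last by ring.
  by rewrite addr_ge0// mulr_ge0//; lra.
have HX : g ((p + q) / 2) * (v - a) <= 4 * (g ((u + v) / 2) * (q - a)).
  have [yx|xy] := leP ((p + q) / 2) ((u + v) / 2).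
    have : g ((p + q) / 2) <= g ((u + v) / 2) by apply: gnd; rewrite ?in_itv/=.
    move=> HG; have : g ((p + q) / 2) * (v - a) <= g ((u + v) / 2) * (q - a).
      by apply: ler_pM => //; lra.
    have : 0 <= g ((u + v) / 2) * (q - a) by rewrite mulr_ge0//; lra.
    by lra.
  have h : ((u + v) / 2 - a) * g ((p + q) / 2) <=
    2 * ((p + q) / 2 - a) * g ((u + v) / 2) by apply: gdbl; lra.
  have h1 : g ((p + q) / 2) * (v - a) <= 2 * (((u + v) / 2 - a) * g ((p + q) / 2)).
    by rewrite mulrC mulrA; apply: ler_wpM2r => //; lra.
  have h2 : ((p + q) / 2 - a) * g ((u + v) / 2) <= g ((u + v) / 2) * (q - a).
    by rewrite mulrC; apply: ler_wpM2l => //; lra.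
  by lra.
have GH : g ((u + v) / 2) <= 4 * g ((p + q) / 2).
  have [xy|yx] := leP ((u + v) / 2) ((p + q) / 2).
    have : g ((u + v) / 2) <= g ((p + q) / 2) by apply: gnd; rewrite ?in_itv/=.
    by lra.
  have h : ((p + q) / 2 - a) * g ((u + v) / 2) <=
    2 * ((u + v) / 2 - a) * g ((p + q) / 2) by apply: gdbl; lra.
  have y0 : 0 < (p + q) / 2 - a by lra.
  rewrite -(ler_pM2l y0); apply: (le_trans h); rewrite mulrA.
  by apply: ler_wpM2r => //; lra.
(* One of v - a and b - u is at least half of b - a. It absorbs the factor q - a or b - p, and [sW]
   or [sY] handles the rest. *)
have sYW : (v - u) * ((q - a) * (b - p)) <= 2 * (q - p) * ((v - a) * (b - u)).
  have [h|h] := leP (b - a) (2 * (v - a)).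
    have -> : (v - u) * ((q - a) * (b - p)) = (q - a) * ((v - u) * (b - p)) by ring.
    have -> : 2 * (q - p) * ((v - a) * (b - u)) =
      2 * (v - a) * ((q - p) * (b - u)) by ring.
    by apply: ler_pM => //; try apply: mulr_ge0; lra.
  have -> : (v - u) * ((q - a) * (b - p)) = (b - p) * ((v - u) * (q - a)) by ring.
  have -> : 2 * (q - p) * ((v - a) * (b - u)) =
    2 * (b - u) * ((q - p) * (v - a)) by ring.
  by apply: ler_pM => //; try apply: mulr_ge0; lra.
have sq u' v' : a <= u' -> u' < v' -> v' <= b ->
    (g ((u' + v') / 2) * (v' - u')) ^+ 2 <=
      4 * (pi * mass mu u' v') ^+ 2 * ((v' - a) * (b - u')) /\
    (pi * mass mu u' v') ^+ 2 * ((v' - a) * (b - u')) <=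
      16 ^+ 2 * (g ((u' + v') / 2) * (v' - u')) ^+ 2.
  move=> au' uv' vb'.
  have [lo up] := mass_bounds g0 gnd gdbl mud au' uv' vb'.
  have S0 : 0 < (v' - a) * (b - u') by rewrite mulr_gt0//; lra.
  have m0 : 0 <= mass mu u' v' by rewrite fine_ge0.
  have g0' : 0 <= g ((u' + v') / 2) by apply: g0; rewrite in_itv/=; lra.
  have SS := sqr_sqrtr (ltW S0); have S0' := S0; rewrite -sqrtr_gt0 in S0'.
  move: lo up S0' SS; move: (Num.sqrt _) => S + + S0' <-.
  have : 0 <= g ((u' + v') / 2) * (v' - u') by rewrite mulr_ge0//; lra.
  have : 0 <= pi * mass mu u' v' by rewrite mulr_ge0// ltW.
  move: (_ * mass _ _ _) (_ * (v' - u')) => M k M0 k0.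
  rewrite ler_pdivrMr// mulrA ler_pdivlMr// => lo up.
  split.
    have -> : 4 * M ^+ 2 * S ^+ 2 = (2 * M * S) ^+ 2 by ring.
    by rewrite lerXn2r// nnegrE !mulr_ge0// ltW.
  by rewrite -!exprMn lerXn2r// nnegrE; nneg.
have s0 : 0 < v - u by lra.
have L0 : 0 < q - p by lra.
have X0 : 0 < v - a by lra.
have Y0 : 0 < q - a by lra.
have Z0 : 0 < b - u by lra.
have ZW : b - u <= b - p by lra.
have au : a <= u by lra.
have vb : v <= b by lra.
have [loS upS] := sq _ _ au uv vb; have [loI upI] := sq _ _ ap pq qb.
have c0 : 0 <= 16 ^+ 2 :> R by exact: sqr_ge0.
have pp : 0 < pi ^+ 2 :> R by rewrite exprn_gt0.
split; rewrite -(ler_pM2l pp).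
  have h := regular_lower_algebra c0 s0 L0 X0 Y0 Z0 ZW G0 H0 sY HX loS upI.
  have x0 : 0 <= 64 * 16 ^+ 2 * (pi * mass mu u v) ^+ 2 * (q - p) ^+ 3 by nneg.
  have -> : pi ^+ 2 * ((v - u) ^+ 3 * mass mu p q ^+ 2) =
    (v - u) ^+ 3 * (pi * mass mu p q) ^+ 2 by ring.
  have -> : pi ^+ 2 * (128 * 16 ^+ 2 * mass mu u v ^+ 2 * (q - p) ^+ 3) =
    64 * 16 ^+ 2 * (pi * mass mu u v) ^+ 2 * (q - p) ^+ 3 *+ 2 by ring.
  by rewrite mulr2n; lra.
have h := regular_upper_algebra c0 s0 L0 X0 Y0 Z0 (lt_le_trans Z0 ZW) G0 GH sYW upS loI.
have -> : pi ^+ 2 * (mass mu u v ^+ 2 * (q - p)) =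
  (pi * mass mu u v) ^+ 2 * (q - p) by ring.
by rewrite (_ : pi ^+ 2 * _ = 128 * 16 ^+ 2 * (v - u) * (pi * mass mu p q) ^+ 2) //; ring.
Qed.

End Regularity.

(** * Subdivision into intervals of equal mass *)

Section Quantiles.
Context {R : realType} (mu : probability (measurableTypeR R) R).
Variables (a b K : R).
Hypotheses (ab : a < b) (K0 : 0 <= K).
Hypothesis reg : regular_mass K a b (mass mu).
Hypothesis full : mass mu a b = 1.

Lemma mass_ge0 u v : 0 <= mass mu u v.
Proof. by rewrite fine_ge0. Qed.

Lemma massE u v : mu `]u, v]%classic = (mass mu u v)%:E.
Proof. by rewrite /mass fineK// fin_num_measure. Qed.

Lemma massD u v w : u <= v -> v <= w -> mass mu u v + mass mu v w = mass mu u w.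
Proof.
move=> uv vw; apply: EFin_inj; rewrite EFinD -!massE.
have -> : `]u, w]%classic = `]u, v] `|` `]v, w].
  by rewrite -itv_bndbnd_setU ?bnd_simp.
rewrite measureU//; apply/seteqP; split => // x [/=]; rewrite !in_itv/=.
by move=> /andP[_ xv] /andP[/(le_lt_trans xv)]; rewrite ltxx.
Qed.

(** The upper half of regularity, with [a, b] as the outer interval, makes the distribution function
    Hölder continuous of exponent 1/2. *)
Lemma continuous_mass : {within `[a, b], continuous (mass mu a)}.
Proof.
have lip x y : a <= x -> x <= y -> y <= b ->
    (mass mu a y - mass mu a x) ^+ 2 * (b - a) <= K * (y - x).
  move=> ax xy yb; rewrite -(massD ax xy) addrC addKr.
  have [_] := reg (lexx a) ax xy yb (lexx b).
  by rewrite full expr1n mulr1.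
have lip' x y : a <= x <= b -> a <= y <= b ->
    (mass mu a x - mass mu a y) ^+ 2 * (b - a) <= K * `|x - y|.
  move=> /andP[ax xb] /andP[ay yb]; have [xy|/ltW yx] := leP x y.
    rewrite -sqrrN opprB distrC ger0_norm ?subr_ge0//; exact: lip.
  by rewrite ger0_norm ?subr_ge0//; exact: lip.
apply/subspace_continuousP => x /=; rewrite in_itv/= => xI.
apply/cvgrPdist_lt => e e0; rewrite near_withinE.
(* Dividing by K + 1 avoids the case K = 0. *)
have d0 : 0 < e ^+ 2 * (b - a) / (K + 1).
  by rewrite divr_gt0 ?mulr_gt0 ?exprn_gt0 ?subr_gt0// ltr_wpDl.
near=> y => yI; rewrite /= in_itv/= in yI.
have xy : `|x - y| < e ^+ 2 * (b - a) / (K + 1).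
  by near: y; exact: nbhsx_ballx.
rewrite -(ltr_pXn2r (n := 2))// ?nnegrE ?ltW//.
rewrite real_normK ?num_real// -(@ltr_pM2r _ (b - a)) ?subr_gt0//.
apply: (le_lt_trans (lip' _ _ xI yI)).
move: xy; rewrite ltr_pdivlMr ?ltr_wpDl// => xy.
apply: le_lt_trans xy; rewrite mulrC mulrDr mulr1 lerDl; exact: normr_ge0.
Unshelve. all: by end_near. Qed.

Lemma quantile c : 0 <= c <= 1 -> exists t, a <= t <= b /\ mass mu a t = c.
Proof.
move=> /andP[c0 c1].
have Fa : mass mu a a = 0 by rewrite /mass set_itv_ge ?measure0// bnd_simp ltxx.
have := IVT (ltW ab) continuous_mass; move=> /(_ c).
rewrite Fa full minEle maxEle ler01 c0 c1 => -[]// t tI <-.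
by exists t; split => //; move: tI; rewrite in_itv.
Qed.

(** The points are quantiles, given by the intermediate value theorem. The lower half of regularity
    shows that an interval of mass zero is degenerate, which pins the extreme quantiles to a and
    b. *)
Lemma equal_mass_subdivision k : (0 < k)%N ->
  exists tau : nat -> R, [/\ tau 0%N = a, tau k = b &
    forall i j, (i < j)%N -> (j <= k)%N ->
      tau i < tau j /\ mass mu (tau i) (tau j) = (j - i)%:R / k%:R].
Proof.
move=> k0.
have kR : 0 < k%:R :> R by rewrite ltr0n.
(* Truncating at k makes the level admissible for every natural number i. *)
have /choice[tau tauP] : forall i, exists t,
    a <= t <= b /\ mass mu a t = (minn i k)%:R / k%:R.
  move=> i; apply: quantile; rewrite divr_ge0//= ler_pdivrMr// mul1r ler_nat.
  exact: geq_minr.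
have tauI i : a <= tau i <= b by case: (tauP i).
have tauM i : (i <= k)%N -> mass mu a (tau i) = i%:R / k%:R.
  by move=> ik; have [_ ->] := tauP i; rewrite (minn_idPl ik).
have lo u v : a <= u -> u <= v -> v <= b -> mass mu u v = 0 -> u = v.
  move=> au uv vb m0; have [] := reg (lexx a) au uv vb (lexx b).
  rewrite full m0 expr1n mulr1 expr0n/= mulr0 mul0r => h _.
  have : (v - u) ^+ 3 == 0 by rewrite eq_le h/= exprn_ge0// subr_ge0.
  by rewrite expf_eq0/= subr_eq0 => /eqP.
exists tau; split.
- have /andP[at0 t0b] := tauI 0%N; apply/esym; apply: lo => //.
  by rewrite tauM// mul0r.
- have /andP[at0 t0b] := tauI k; apply: lo => //.
  by apply: (@addrI _ (mass mu a (tau k))); rewrite massD// full tauM// divff ?addr0// gt_eqF.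
- move=> i j ij jk; have ik := leq_trans (ltnW ij) jk.
  have /andP[ai ib] := tauI i; have /andP[aj jb] := tauI j.
  have lt : tau i < tau j.
    rewrite ltNge; apply/negP => ji; have := massD aj ji.
    rewrite !tauM// => h; have := mass_ge0 (tau j) (tau i).
    have : i%:R / k%:R < j%:R / k%:R :> R by rewrite ltr_pM2r ?invr_gt0// ltr_nat.
    by lra.
  split=> //; have := massD ai (ltW lt); rewrite !tauM// natrB ?(ltnW ij)//.
  by rewrite mulrBl => <-; ring.
Qed.
End Quantiles.

(** * Logarithmic integrals over one interval *)

Section LogIntegral.
Context {R : realType} (mu : probability (measurableTypeR R) R).
Variables (a b K : R).
Hypotheses (K0 : 0 <= K).
Hypothesis reg : regular_mass K a b (mass mu).

(** This is |z - t|^2 for z = x + iy. *)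
Definition dist2 (x y t : R) : R := (x - t) ^+ 2 + y ^+ 2.

(** Real-valued, so at t = z it takes the default value [ln 0 = 0] instead of minus infinity. *)
Definition ln_dist (x y t : R) : R := ln (Num.sqrt (dist2 x y t)).

Lemma measurable_dist2 x y : measurable_fun setT (dist2 x y).
Proof.
apply: measurable_funD => //; apply: measurable_funX; exact: measurable_funB.
Qed.

Lemma measurable_sqrt_dist2 x y :
  measurable_fun setT (fun t => Num.sqrt (dist2 x y t)).
Proof.
apply: measurableT_comp (measurable_dist2 x y).
by apply: continuous_measurable_fun; exact: sqrt_continuous.
Qed.

Lemma measurable_ln_dist x y : measurable_fun setT (ln_dist x y).
Proof.
by apply: measurableT_comp (measurable_sqrt_dist2 x y); exact: measurable_ln.
Qed.

(* [4^n] and not [2^n], so that the square root in the ball estimate is exact *)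
Definition ball_itv (p q x y : R) (n : nat) : set R :=
  [set t | p < t <= q /\ Num.sqrt (dist2 x y t) < (q - p) * 4 ^- n].

Lemma measurable_ball_itv p q x y n : measurable (ball_itv p q x y n).
Proof.
rewrite (_ : ball_itv p q x y n =
  [set` `]p, q]] `&` ((fun t => Num.sqrt (dist2 x y t)) @^-1` `]-oo, (q - p) * 4 ^- n[)).
  by apply: measurableI => //; rewrite -[X in measurable X]setTI;
     exact: measurable_sqrt_dist2.
by apply/seteqP; split=> t; rewrite /ball_itv/= !in_itv.
Qed.

(** The set lies in an interval of length at most 2 * (q - p) * 4^-n, to which the upper half of
    regularity applies. *)
Lemma mass_ball_itv p q x y n : a <= p -> p < q -> q <= b ->
  fine (mu (ball_itv p q x y n)) <= Num.sqrt (2 * K) * 2 ^- n * mass mu p q.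
Proof.
move=> ap pq qb; pose r := (q - p) * 4 ^- n.
pose u := Num.max p (x - r); pose v := Num.min q (x + r).
have m0 := mass_ge0 mu p q.
have RHS0 : 0 <= Num.sqrt (2 * K) * 2 ^- n * mass mu p q.
  by rewrite !mulr_ge0// ?sqrtr_ge0// invr_ge0 exprn_ge0.
have sub : ball_itv p q x y n `<=` `]u, v].
  move=> t [/andP[pt tq] h]; rewrite /= in_itv/=.
  have : `|x - t| < r.
    rewrite -sqrtr_sqr; apply: le_lt_trans h; apply: ler_wsqrtr.
    by rewrite lerDl sqr_ge0.
  rewrite ltr_norml => /andP[h1 h2].
  by rewrite gt_max le_min pt tq/=; apply/andP; split; lra.
have le1 : fine (mu (ball_itv p q x y n)) <= mass mu u v.
  apply: fine_le; rewrite ?fin_num_measure//; first exact: measurable_ball_itv.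
  by apply: le_measure; rewrite ?inE//; exact: measurable_ball_itv.
apply: (le_trans le1).
have [vu|uv] := ltP v u.
  by rewrite /mass set_itv_ge ?measure0// bnd_simp -leNgt ltW.
have pu : p <= u by rewrite le_max lexx.
have vq : v <= q by rewrite ge_min lexx.
have [_ h] := reg ap pu uv vq qb.
have vur : v - u <= 2 * r.
  have : v <= x + r by rewrite ge_min lexx orbT.
  have : x - r <= u by rewrite le_max lexx orbT.
  by lra.
rewrite -(ler_pXn2r (n := 2))// ?nnegrE//; last exact: mass_ge0.
have L0 : 0 < q - p by rewrite subr_gt0.
rewrite -(ler_pM2r L0) (le_trans h)//.
apply: (@le_trans _ _ (K * (2 * r) * mass mu p q ^+ 2)).
  by apply: ler_wpM2r; [exact: sqr_ge0|exact: ler_wpM2l].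
rewrite !exprMn sqr_sqrtr ?mulr_ge0// exprVn -exprM mulnC exprM /r.
by rewrite (_ : 2 ^+ 2 = 4); [rewrite le_eqVlt; apply/orP; left; apply/eqP; ring|ring].
Qed.

(** Layer-cake bound: if N is the first scale with (q - p) * 4^-N <= |z - t|, then t lies in the N
    larger balls, each contributing ln 4, and the logarithm on the left is at most N * ln 4. *)
Lemma ln_dist_le_dyadic p q x y t : p < t <= q ->
  ((ln (q - p) - ln_dist x y t)%:E <=
   \sum_(n <oo) (ln 4 * \1_(ball_itv p q x y n) t)%:E)%E.
Proof.
move=> tI; pose w := Num.sqrt (dist2 x y t).
have L0 : 0 < q - p by have := tI; lra.
have l4 : 0 < ln 4 :> R by rewrite ln_gt0 ?ltr1n.
have pos4 n : 0 < 4 ^+ n :> R by rewrite exprn_gt0.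
have [N [BN lnN]] : exists N, (forall n, (n < N)%N -> w < (q - p) * 4 ^- n) /\
    ln (q - p) - ln w <= N%:R * ln 4.
  have [w0|w0] := ltP 0 w; last first.
    (* At t = z every ball contains t, while the default [ln 0 = 0] leaves only ln (q - p) to be
       bounded. *)
    have w0' : w = 0 by apply/eqP; rewrite eq_le w0 sqrtr_ge0.
    exists (Num.truncn (ln (q - p) / ln 4)).+1; split.
      by move=> n _; rewrite w0' mulr_gt0// invr_gt0.
    rewrite w0' [ln 0]ln0// subr0 -ler_pdivrMr//; exact/ltW/truncnS_gt.
  have ex : exists n, (q - p) * 4 ^- n <= w.
    exists (Num.truncn ((q - p) / w)).+1; rewrite ler_pdivrMr// mulrC -ler_pdivrMr//.
    apply: (le_trans (ltW (truncnS_gt _))).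
    by rewrite -natrX ler_nat ltnW// ltn_expl.
  case: (ex_minnP ex) => N hN minN; exists N; split.
    by move=> n nN; rewrite ltNge; apply/negP => /minN; rewrite leqNgt nN.
  rewrite lerBlDr mulr_natl -lnXn// -lnM ?posrE//.
  by rewrite ler_ln ?posrE ?mulr_gt0// mulrC -ler_pdivrMr.
apply: (@le_trans _ _ (N%:R * ln 4)%:E); first by rewrite lee_fin.
apply: (@le_trans _ _
   (\sum_(0 <= n < N) (ln 4 * \1_(ball_itv p q x y n) t)%:E)%E); last first.
  by apply: nneseries_lim_ge => n _ _; rewrite lee_fin mulr_ge0// ltW.
rewrite sumEFin lee_fin (eq_big_nat _ _ (F2 := fun=> ln 4)) => [|n /andP[_ nN]].
  by rewrite sumr_const_nat subn0 mulr_natl.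
by rewrite indicE mem_set ?mulr1//; split => //; exact: BN.
Qed.

(** The factor 2 is the sum of the series of 2^-n. *)
Definition near_cst : R := 2 * ln 4 * Num.sqrt (2 * K).

Lemma near_cst_ge0 : 0 <= near_cst.
Proof. by rewrite !mulr_ge0 ?sqrtr_ge0 ?ln_ge0// ler1n. Qed.

Lemma integral_ln_dist_pos_le p q x y : a <= p -> p < q -> q <= b ->
  (\int[mu]_(t in `]p, q]) (Num.max 0 (ln (q - p) - ln_dist x y t))%:E <=
   (near_cst * mass mu p q)%:E)%E.
Proof.
move=> ap pq qb.
have l4 : 0 <= ln 4 :> R by rewrite ln_ge0 ?ler1n.
have mB := measurable_ball_itv p q x y.
have mh n : measurable_fun `]p, q]
    (fun t => (ln 4 * \1_(ball_itv p q x y n) t)%:E).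
  by apply/measurable_EFinP; apply: measurable_funM.
have h0 n t : (0 <= (ln 4 * \1_(ball_itv p q x y n) t)%:E :> \bar R)%E.
  by rewrite lee_fin mulr_ge0.
apply: (@le_trans _ _ (\int[mu]_(t in `]p, q])
    \sum_(n <oo) (ln 4 * \1_(ball_itv p q x y n) t)%:E)%E).
  apply: ge0_le_integral => //=.
  - by move=> t _; rewrite lee_fin le_max lexx.
  - apply/measurable_EFinP; apply: measurable_maxr => //.
    by apply: measurable_funB => //; apply: measurable_funTS; exact: measurable_ln_dist.
  - apply: (ge0_emeasurable_sum (P := xpredT)) => [n t _ _|n _]; first exact: h0.
    exact: mh.
  - move=> t; rewrite in_itv/= => tI; rewrite EFin_max ge_max.
    by rewrite nneseries_ge0//= ln_dist_le_dyadic.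
rewrite integral_nneseries//; last by move=> n; exact: mh.
(* The geometric series used below starts at r / 2, hence the doubling. *)
pose r := 2 * (ln 4 * Num.sqrt (2 * K) * mass mu p q).
have -> : near_cst * mass mu p q = r / 2 ^+ 0 by rewrite /near_cst /r expr0 divr1; ring.
rewrite -(cvg_lim _ (@cvg_geometric_eseries_half R r 0))//.
apply: lee_nneseries => [n _ _|n _]; first exact: integral_ge0.
under eq_integral do rewrite EFinM.
rewrite ge0_integralZl_EFin//; last first.
  by apply/measurable_EFinP; apply: measurable_indic; exact: mB.
have -> : (\int[mu]_(t in `]p, q]) (\1_(ball_itv p q x y n) t)%:E =
    mu (ball_itv p q x y n))%E.
  rewrite integral_indic//; last exact: mB.
  by rewrite setIidl// => t [].
have -> : mu (ball_itv p q x y n) = (fine (mu (ball_itv p q x y n)))%:E.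
  by rewrite fineK// fin_num_measure//; exact: mB.
rewrite -EFinM lee_fin.
apply: (le_trans (ler_wpM2l l4 (mass_ball_itv x y n ap pq qb))).
rewrite le_eqVlt; apply/orP; left; apply/eqP; rewrite /r natrX addn1 exprS.
by field; rewrite expf_neq0.
Qed.

End LogIntegral.

(** * Pointwise expansions of the logarithm *)

Section LogElementary.
Context {R : realType}.
Implicit Types x y t c p q u L : R.

Lemma ln_ge_onem_inv u : 0 < u -> 1 - u^-1 <= ln u.
Proof.
move=> u0; have := le_ln1Dx (x := u^-1 - 1).
have -> : 1 + (u^-1 - 1) = u^-1 by ring.
rewrite lnV ?posrE// => /(_ _)/wrap[]; last by lra.
by rewrite ltrBrDl subrr invr_gt0.
Qed.

Lemma ln1D_ge u : - 2^-1 <= u -> u - 2 * u ^+ 2 <= ln (1 + u).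
Proof.
move=> hu; have u0 : 0 < 1 + u by lra.
apply: le_trans (ln_ge_onem_inv u0).
rewrite -subr_ge0 (_ : _ - _ = u ^+ 2 * (1 + 2 * u) / (1 + u)); last first.
  by field; rewrite gt_eqF.
by apply: divr_ge0; [apply: mulr_ge0; [exact: sqr_ge0|lra]|lra].
Qed.

Lemma ln_distE x y t : 0 < dist2 x y t -> ln_dist x y t = ln (dist2 x y t) / 2.
Proof.
move=> d0; rewrite -[X in ln X / 2](sqr_sqrtr (ltW d0)) lnXn ?sqrtr_gt0//.
by rewrite mulr2n /ln_dist; lra.
Qed.

(* Second order Taylor expansion of [ln |z - t|] at [t = c]; the first order
   term integrates to [0] when [c] is the barycenter. *)
Lemma ln_dist_far x y t c L : `|t - c| <= L -> 64 * L ^+ 2 <= dist2 x y c ->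
  0 < dist2 x y c ->
  ln_dist x y c - (x - c) / dist2 x y c * (t - c) - 9 * L ^+ 2 / dist2 x y c
    <= ln_dist x y t.
Proof.
move=> tcL LD D0; have L0 : 0 <= L by exact: le_trans tcL.
have := sqr_sqrtr (ltW D0); have := D0; rewrite -sqrtr_gt0.
have xcS : `|x - c| <= Num.sqrt (dist2 x y c).
  by rewrite -sqrtr_sqr; apply: ler_wsqrtr; rewrite lerDl sqr_ge0.
have LS : 8 * L <= Num.sqrt (dist2 x y c).
  have -> : 8 * L = Num.sqrt ((8 * L) ^+ 2).
    by rewrite sqrtr_sqr ger0_norm// mulr_ge0.
  by apply: ler_wsqrtr; apply: le_trans LD; rewrite exprMn -natrX.
move: xcS LS; set D := dist2 x y c; move: (Num.sqrt D) => S xcS LS S0 SD.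
(* Here v = |z - t|^2 - |z - c|^2. With S = |z - c| and 8 * L <= S, |v| <= 2 * S * L + L^2 <= 3 * S
   * L, so u >= - 1/2 and u^2 <= 9 * L^2 / D. Halving ln (1 + u) turns the error 2 * u^2 into
   u^2. *)
pose v := - 2 * (x - c) * (t - c) + (t - c) ^+ 2.
pose u := v / D.
have DE : dist2 x y t = D * (1 + u).
  by rewrite mulrDr mulr1 /u mulrC divfK ?gt_eqF// /v /D /dist2; ring.
have vSL : `|v| <= 3 * S * L.
  have h1 : `|x - c| * `|t - c| <= S * L by exact: ler_pM.
  have h2 : `|t - c| ^+ 2 <= L * S.
    rewrite expr2; apply: ler_pM => //; lra.
  apply: (le_trans (ler_normD _ _)).
  by rewrite normrX !normrM normrN (ger0_norm (ler0n _ 2)) -mulrA; lra.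
have u2 : u ^+ 2 <= 9 * L ^+ 2 / D.
  rewrite /u exprMn exprVn ler_pdivrMr ?exprn_gt0// -real_normK ?num_real//.
  have -> : 9 * L ^+ 2 / D * D ^+ 2 = 9 * L ^+ 2 * D by field; rewrite gt_eqF.
  rewrite -SD (_ : 9 * L ^+ 2 * S ^+ 2 = (3 * S * L) ^+ 2); last by ring.
  by rewrite lerXn2r// nnegrE// !mulr_ge0// ltW.
have uge : - 2^-1 <= u.
  rewrite /u ler_pdivlMr// -SD.
  have : - `|v| <= v by rewrite lerNl -normrN ler_norm.
  nra.
have D1 : 0 < D * (1 + u) by rewrite mulr_gt0//; lra.
rewrite !ln_distE ?DE// lnM ?posrE//; last by lra.
have := ln1D_ge uge.
have : u / 2 >= - ((x - c) / D * (t - c)).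
  have -> : u / 2 = - ((x - c) / D * (t - c)) + (t - c) ^+ 2 / D / 2.
    by rewrite /u /v; field; rewrite gt_eqF.
  by rewrite lerDl !divr_ge0 ?sqr_ge0// ltW.
rewrite -/D; lra.
Qed.

(** The right side is the tangent line at c of the concave function ln |x - t|. The positive ratio
    says that t and c lie on the same side of x, and ln (1 + r) <= r concludes. *)
Lemma ln_dist_jensen x t c : 0 < (x - t) / (x - c) ->
  ln_dist x 0 t <= ln_dist x 0 c + (c - t) / (x - c).
Proof.
move=> r0.
have xc : x - c != 0 by apply: contraTneq r0 => ->; rewrite invr0 mulr0 ltxx.
have xt : x - t != 0 by apply: contraTneq r0 => ->; rewrite mul0r ltxx.
have E s : dist2 x 0 s = (x - s) ^+ 2 by rewrite /dist2 expr0n/= addr0.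
rewrite /ln_dist !E !sqrtr_sqr.
have -> : `|x - t| = (x - t) / (x - c) * `|x - c|.
  by rewrite -{1}(divfK xc (x - t)) normrM gtr0_norm.
rewrite lnM ?posrE ?normr_gt0// addrC lerD2l.
have -> : (x - t) / (x - c) = 1 + (c - t) / (x - c) by field.
apply: le_ln1Dx; move: r0.
have -> : (x - t) / (x - c) = 1 + (c - t) / (x - c) by field.
by lra.
Qed.
End LogElementary.

(** * Replacing an interval by its barycenter *)

Section Barycenter.
Context {R : realType} (mu : probability (measurableTypeR R) R).
Variables (a b K : R).
Hypotheses (K0 : 0 <= K).
Hypothesis reg : regular_mass K a b (mass mu).
Hypothesis atomless : forall t : R, mu [set t] = 0%E.
Variables (p q : R).
Hypotheses (ap : a <= p) (pq : p < q) (qb : q <= b) (m0 : 0 < mass mu p q).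

Let m := mass mu p q.
Let L := q - p.

Definition barycenter : R := (\int[mu]_(t in `]p, q]) t) / mass mu p q.
Let c := barycenter.

Lemma integrable_itv_bounded (f : R -> R) (M : R) :
  measurable_fun [set` `]p, q]] f -> (forall t, p < t <= q -> `|f t| <= M) ->
  mu.-integrable `]p, q] (EFin \o f).
Proof.
move=> mf fM; apply: (@le_integrable _ _ _ mu _ _ _ (EFin \o cst M)) => //.
- exact/measurable_EFinP.
- move=> t; rewrite /= in_itv/= => tI; rewrite lee_fin.
  by rewrite (le_trans (fM _ tI))// ler_norm.
- exact: finite_measure_integrable_cst.
Qed.

Lemma integrable_affine (k l : R) :
  mu.-integrable `]p, q] (EFin \o (fun t => k + l * t)).
Proof.
apply: (@integrable_itv_bounded _ (`|k| + `|l| * (`|p| + `|q|))).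
  by apply: measurable_funD => //; apply: measurable_funM.
move=> t tI; apply: (le_trans (ler_normD _ _)); rewrite lerD2l normrM.
apply: ler_wpM2l => //; have := ler_norm q; have := ler_norm (- p).
rewrite normrN => h1 h2; rewrite ler_norml.
have := normr_ge0 p; have := normr_ge0 q; lra.
Qed.

Lemma Rintegral_itv_cst (k : R) : \int[mu]_(t in `]p, q]) k = k * m.
Proof. by rewrite Rintegral_cst. Qed.

(** This removes the first order terms in both the Taylor estimate and Jensen's inequality. *)
Lemma Rintegral_affine (k l : R) :
  \int[mu]_(t in `]p, q]) (k + l * t) = (k + l * c) * m.
Proof.
have hid : mu.-integrable `]p, q] (EFin \o id).
  rewrite [X in integrable _ _ X](_ : _ = EFin \o (fun t : R => 0 + 1 * t)).
    exact: integrable_affine.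
  by apply/funext => t /=; rewrite add0r mul1r.
rewrite RintegralD//; last 2 first.
- exact: finite_measure_integrable_cst.
- rewrite [X in integrable _ _ X](_ : _ = EFin \o (fun t : R => 0 + l * t)).
    exact: integrable_affine.
  by apply/funext => t /=; rewrite add0r.
rewrite Rintegral_itv_cst RintegralZl// mulrDl -mulrA.
by rewrite /c /barycenter divfK// gt_eqF.
Qed.

Lemma integrable_ln_dist_pos x y :
  mu.-integrable `]p, q] (EFin \o (fun t => Num.max 0 (ln L - ln_dist x y t))).
Proof.
apply/integrableP; split.
  apply/measurable_EFinP; apply: measurable_maxr => //; apply: measurable_funB => //.
  by apply: measurable_funTS; exact: measurable_ln_dist.
apply: le_lt_trans (_ : (near_cst K * mass mu p q)%:E < +oo)%E; last by rewrite ltry.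
apply: le_trans (integral_ln_dist_pos_le K0 reg x y ap pq qb).
rewrite le_eqVlt; apply/orP; left; apply/eqP; apply: eq_integral => t _ /=.
by rewrite ger0_norm// le_max lexx.
Qed.

(** The function is bounded below through the integrable positive part f and above by a constant,
    because t stays bounded. The summand 1 in W makes the upper bound non-negative, so that it also
    covers the default value at t = z. *)
Lemma integrable_ln_dist x y : mu.-integrable `]p, q] (EFin \o ln_dist x y).
Proof.
pose f t := Num.max 0 (ln L - ln_dist x y t).
have mlnd : measurable_fun `]p, q] (ln_dist x y).
  by apply: measurable_funTS; exact: measurable_ln_dist.
have intf := integrable_ln_dist_pos x y.
pose W := (`|x| + `|p| + `|q|) ^+ 2 + y ^+ 2 + 1.
pose M := `|ln L| + `|ln (Num.sqrt W)|.
apply: (@le_integrable _ _ _ mu _ _ _ ((EFin \o f) \+ (EFin \o cst M))%E) => //.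
- exact/measurable_EFinP.
- move=> t; rewrite /= in_itv/= => tI; rewrite lee_fin.
  rewrite [leRHS]ger0_norm; last first.
    by rewrite addr_ge0// ?le_max ?lexx// addr_ge0.
  rewrite ler_norml; apply/andP; split.
    have : ln L - ln_dist x y t <= f t by rewrite le_max lexx orbT.
    have := ler_norm (- ln L); rewrite normrN.
    have := normr_ge0 (ln (Num.sqrt W)).
    by rewrite /M; lra.
  have : 0 <= f t by rewrite le_max lexx.
  have : ln_dist x y t <= `|ln (Num.sqrt W)|.
    apply: le_trans (ler_norm _).
    have W1 : 1 <= Num.sqrt W.
      rewrite -sqrtr1; apply: ler_wsqrtr.
      by rewrite /W lerDr addr_ge0 ?sqr_ge0.
    have [d0|d0] := ltP 0 (Num.sqrt (dist2 x y t)); last first.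
      by rewrite /ln_dist ln0// ln_ge0.
    rewrite /ln_dist ler_ln ?posrE//; last by rewrite (lt_le_trans _ W1).
    apply: ler_wsqrtr; rewrite /dist2 /W -addrA lerD//; last by rewrite lerDl.
    rewrite -(real_normK (num_real (x - t))).
    have N0 : 0 <= `|x| + `|p| + `|q| by rewrite !addr_ge0.
    rewrite lerXn2r ?nnegrE//.
    apply: (le_trans (ler_normB _ _)); rewrite -addrA lerD2l.
    have := ler_norm q; have := ler_norm (- p).
    rewrite normrN => h1 h2; rewrite ler_norml.
    by have := normr_ge0 p; have := normr_ge0 q; lra.
  by have := normr_ge0 (ln L); rewrite /M; lra.
- by apply: integrableD => //; exact: finite_measure_integrable_cst.
Qed.

(** The half of the interval away from an endpoint has positive mass by the lower half of
    regularity, and its points are at distance at least (q - p) / 2 from that endpoint, so the mean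
    distance is positive. *)
Lemma barycenter_itv : p < c < q.
Proof.
pose r := (p + q) / 2.
have pr : p < r by rewrite /r; have := pq; lra.
have rq : r < q by rewrite /r; have := pq; lra.
have affine_pos (k l : R) (A B : set R) : measurable A -> measurable B ->
    `]p, q]%classic = A `|` B -> [disjoint A & B] ->
    (forall t, A t -> 0 <= k + l * t) ->
    (forall t, B t -> (q - p) / 2 <= k + l * t) ->
    0 < fine (mu B) -> 0 < (k + l * c) * m.
  move=> mA mB AB dAB Age Bge Bpos.
  have iAB : mu.-integrable (A `|` B) (EFin \o (fun t => k + l * t)).
    by rewrite -AB; exact: integrable_affine.
  rewrite -Rintegral_affine AB Rintegral_setU//.
  apply: ltr_wpDl; first exact: Rintegral_ge0.
  apply: (@lt_le_trans _ _ (\int[mu]_(t in B) ((q - p) / 2))).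
    by rewrite Rintegral_cst// mulr_gt0// divr_gt0// subr_gt0.
  apply: le_Rintegral => //; first exact: finite_measure_integrable_cst.
  by apply: integrableS iAB => //; exact: measurableU.
have posm u v : p <= u -> u < v -> v <= q -> 0 < mass mu u v.
  move=> pu uv vq; rewrite lt_neqAle mass_ge0 andbT eq_sym; apply/eqP => uv0.
  have [+ _] := reg ap pu (ltW uv) vq qb.
  rewrite uv0 expr0n/= mulr0 mul0r leNgt => /negP; apply.
  by rewrite mulr_gt0// exprn_gt0// subr_gt0.
have UV : `]p, q]%classic = `]p, r] `|` `]r, q].
  by rewrite -itv_bndbnd_setU ?bnd_simp// ltW.
have dUV : [disjoint `]p, r]%classic & `]r, q]%classic].
  rewrite disj_set2E; apply/eqP/seteqP; split => // t [/=]; rewrite !in_itv/=.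
  by move=> /andP[_ tr] /andP[/(le_lt_trans tr)]; rewrite ltxx.
apply/andP; split.
  suff : 0 < (- p + 1 * c) * m by rewrite pmulr_lgt0// mul1r addrC subr_gt0.
  apply: (affine_pos _ _ `]p, r]%classic `]r, q]%classic) => //.
  - by move=> t; rewrite /= in_itv/=; lra.
  - by move=> t; rewrite /= in_itv/= /r; lra.
  - by apply: posm => //; exact: ltW.
suff : 0 < (q + -1 * c) * m by rewrite pmulr_lgt0// mulN1r subr_gt0.
apply: (affine_pos _ _ `]r, q]%classic `]p, r]%classic) => //.
- by rewrite setUC.
- by rewrite disj_set_sym.
- by move=> t; rewrite /= in_itv/=; lra.
- by move=> t; rewrite /= in_itv/= /r; lra.
- by apply: posm => //; exact: ltW.
Qed.

Lemma ln_dist_integral_near x y :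
  ln L * m - \int[mu]_(t in `]p, q]) ln_dist x y t <= near_cst K * m.
Proof.
have ild := integrable_ln_dist x y.
have icst := @finite_measure_integrable_cst _ _ _ mu _ (ln L) (measurable_itv `]p, q]).
rewrite -Rintegral_itv_cst -RintegralB//.
have iB : mu.-integrable `]p, q] (EFin \o (fun t => ln L - ln_dist x y t)).
  exact: (integrableB _ icst ild).
apply: (@le_trans _ _ (\int[mu]_(t in `]p, q]) Num.max 0 (ln L - ln_dist x y t))).
  apply: le_Rintegral => //; first exact: integrable_ln_dist_pos.
  by move=> t _; rewrite le_max lexx orbT.
rewrite -lee_fin fineK; first exact: (integral_ln_dist_pos_le K0 reg).
by apply: integrable_fin_num => //; exact: integrable_ln_dist_pos.
Qed.

Lemma ln_dist_integral_far x y : 64 * L ^+ 2 <= dist2 x y c -> 0 < dist2 x y c ->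
  ln_dist x y c * m - \int[mu]_(t in `]p, q]) ln_dist x y t <=
    9 * L ^+ 2 / dist2 x y c * m.
Proof.
move=> far D0; have /andP[pc cq] := barycenter_itv.
set D := dist2 x y c; set e := 9 * L ^+ 2 / D.
(* The affine function k + l * t is the Taylor minorant of [ln_dist_far]. *)
pose l := - ((x - c) / D); pose k := ln_dist x y c - e - l * c.
have kE : ln_dist x y c * m - e * m = \int[mu]_(t in `]p, q]) (k + l * t).
  by rewrite Rintegral_affine /k; ring.
rewrite lerBlDr addrC -lerBlDr kE.
apply: le_Rintegral => //; [exact: integrable_affine|exact: integrable_ln_dist|].
move=> t; rewrite /= in_itv/= => /andP[pt tq].
have tcL : `|t - c| <= L by rewrite ler_norml /L; lra.
have := ln_dist_far tcL far D0.
by rewrite -/D -/e /k /l; lra.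
Qed.

(** The sum of the constants of the near case |z - c| < 8 * L and of the far case. *)
Definition piece_cst : R := 64 * (ln 8 + near_cst K) + 9.

Lemma piece_cst_ge0 : 0 <= piece_cst.
Proof.
have := near_cst_ge0 K; have : 0 <= ln 8 :> R by rewrite ln_ge0// ler1n.
by rewrite /piece_cst; lra.
Qed.

(** Together the two bounds say that the error is at most a constant times m * min 1 (L^2 / |z -
    c|^2). In the near case ln |z - c| <= ln (8 * L), and L^2 / |z - c|^2 is bounded below by
    1/64. *)
Lemma ln_dist_integral_le x y : 0 < dist2 x y c ->
  let E := ln_dist x y c * m - \int[mu]_(t in `]p, q]) ln_dist x y t in
  E <= piece_cst * m /\ E * dist2 x y c <= piece_cst * L ^+ 2 * m.
Proof.
move=> D0 E; have nc := near_cst_ge0 K.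
have L0 : 0 < L by rewrite subr_gt0.
have l8 : 0 <= ln 8 :> R by rewrite ln_ge0// ler1n.
have [far|near] := leP (64 * L ^+ 2) (dist2 x y c).
  have h : E <= 9 * L ^+ 2 / dist2 x y c * m := ln_dist_integral_far far D0.
  have h9 : 9 <= piece_cst by rewrite /piece_cst; lra.
  have LD : L ^+ 2 / dist2 x y c <= 1.
    by rewrite ler_pdivrMr// mul1r; have := sqr_ge0 L; lra.
  split; first (apply: (le_trans h); apply: ler_wpM2r; first exact: ltW).
    by rewrite -mulrA; lra.
  move: h; rewrite -(ler_pM2r D0) => /le_trans; apply.
  have -> : 9 * L ^+ 2 / dist2 x y c * m * dist2 x y c = 9 * (L ^+ 2 * m).
    by field; rewrite gt_eqF.
  by rewrite -mulrA; apply: ler_wpM2r => //; rewrite mulr_ge0 ?sqr_ge0// ltW.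
have h := ln_dist_integral_near x y.
have hc : ln_dist x y c <= ln 8 + ln L.
  rewrite -lnM ?posrE// /ln_dist ler_ln ?posrE ?sqrtr_gt0 ?mulr_gt0//.
  have -> : 8 * L = Num.sqrt ((8 * L) ^+ 2).
    by rewrite sqrtr_sqr ger0_norm// mulr_ge0// ltW.
  by apply: ler_wsqrtr; rewrite exprMn -natrX; exact: ltW.
have hE : E <= (ln 8 + near_cst K) * m.
  have h2 : ln_dist x y c * m <= (ln 8 + ln L) * m by apply: ler_wpM2r => //; exact: ltW.
  by move: h h2; rewrite /E !mulrDl; lra.
have B0 : 0 <= ln 8 + near_cst K by rewrite addr_ge0.
split; first by apply: (le_trans hE); apply: ler_wpM2r; [exact: ltW|rewrite /piece_cst; lra].
move: hE; rewrite -(ler_pM2r D0) => /le_trans; apply.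
apply: (@le_trans _ _ ((ln 8 + near_cst K) * m * (64 * L ^+ 2))).
  by apply: ler_wpM2l; [rewrite mulr_ge0// ltW|exact: ltW].
have -> : (ln 8 + near_cst K) * m * (64 * L ^+ 2) =
  64 * (ln 8 + near_cst K) * (L ^+ 2 * m) by ring.
rewrite -[leRHS]mulrA; apply: ler_wpM2r; first by rewrite mulr_ge0 ?sqr_ge0// ltW.
by rewrite /piece_cst; lra.
Qed.

(** Dropping q matters when x = q: the tangent inequality requires t different from x. *)
Lemma Rintegral_itv_oc_oo (f : R -> R) : mu.-integrable `]p, q] (EFin \o f) ->
  \int[mu]_(t in `]p, q]) f t = \int[mu]_(t in `]p, q[) f t.
Proof.
move=> intf.
have E : `]p, q]%classic = `]p, q[ `|` [set q].
  by rewrite (setUitv1 true) ?bnd_simp.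
rewrite E in intf *.
rewrite Rintegral_setU//; last first.
  rewrite disj_set2E; apply/eqP/seteqP; split => // t [/= + tq].
  by rewrite in_itv/= tq ltxx andbF.
rewrite [X in _ + X](_ : _ = 0) ?addr0// /Rintegral null_set_integral//.
  apply: (measurable_funS _ _ (measurable_int _ intf)).
    by apply: measurableU.
  by move=> t ?; right.
exact: atomless.
Qed.

Lemma ln_dist_integral_ge x : (x <= p) || (q <= x) ->
  \int[mu]_(t in `]p, q]) ln_dist x 0 t <= ln_dist x 0 c * m.
Proof.
move=> xpq; have /andP[pc cq] := barycenter_itv.
have xc : x - c != 0 by rewrite subr_eq0; apply/eqP => xc; move: xpq; lra.
pose l := - (x - c)^-1; pose k := ln_dist x 0 c - l * c.
have -> : ln_dist x 0 c * m = \int[mu]_(t in `]p, q]) (k + l * t).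
  by rewrite Rintegral_affine /k; ring.
have ild := integrable_ln_dist x 0; have iaf := integrable_affine k l.
have sub : `]p, q[%classic `<=` `]p, q]%classic by apply: subset_itvl; rewrite bnd_simp.
rewrite !Rintegral_itv_oc_oo//.
have ile (f : R -> R) : mu.-integrable `]p, q] (EFin \o f) ->
    mu.-integrable `]p, q[ (EFin \o f) by apply: integrableS.
apply: le_Rintegral => //; [exact: ile|exact: ile|].
move=> t; rewrite /= in_itv/= => /andP[pt tq].
have -> : k + l * t = ln_dist x 0 c + (c - t) / (x - c) by rewrite /k /l; ring.
apply: ln_dist_jensen; case/orP: xpq => h.
  by rewrite nmulr_rgt0 ?invr_lt0; lra.
by rewrite divr_gt0//; lra.
Qed.

End Barycenter.

(** * Summation over the subdivision *)

Section Weights.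
Context {R : realType}.

(** With cube roots, n^(-4/3) becomes an integer power and the estimates become polynomial. *)
Definition cbrt (n : nat) : R := powR n%:R 3^-1.

Lemma cbrtK n : cbrt n ^+ 3 = n%:R.
Proof. by rewrite /cbrt -powR_mulrn ?powR_ge0// -powRrM mulVf// powRr1. Qed.

Lemma cbrt_gt0 n : (0 < n)%N -> 0 < cbrt n.
Proof. by move=> n0; rewrite powR_gt0// ltr0n. Qed.

(* Index [0] stands for the interval that contains [Re z]. *)
Definition weight (n : nat) : R := cbrt (maxn n 1) ^- 4.

Lemma weight_ge0 n : 0 <= weight n.
Proof. by rewrite invr_ge0 exprn_ge0// powR_ge0. Qed.

(** Telescoping form of the integral test for n^(-4/3). With s and r the two cube roots, r^3 - s^3 =
    1 and r^2 + r * s + s^2 <= 3 * r^2. *)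
Lemma weightS_le n : (0 < n)%N -> weight n.+1 <= 3 * ((cbrt n)^-1 - (cbrt n.+1)^-1).
Proof.
move=> n0; rewrite /weight (maxn_idPl _)//.
have s0 := cbrt_gt0 n0; have r0 := cbrt_gt0 (ltn0Sn n).
have := cbrtK n.+1; rewrite -addn1 natrD -(cbrtK n) addn1.
move: s0 r0; move: (cbrt n) (cbrt n.+1) => s r s0 r0 rs.
have [s0' r0'] := (ltW s0, ltW r0).
have sr : s <= r by rewrite -(ler_pXn2r (n := 3))// rs lerDl.
have e : (r - s) * (r ^+ 2 + r * s + s ^+ 2) = 1.
  by transitivity (r ^+ 3 - s ^+ 3); [ring|rewrite rs; ring].
have p0 : 0 < r * s * r ^+ 3 by rewrite !mulr_gt0// exprn_gt0.
rewrite -(ler_pM2r p0).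
have -> : r ^- 4 * (r * s * r ^+ 3) = s by field; rewrite gt_eqF.
have -> : 3 * (s^-1 - r^-1) * (r * s * r ^+ 3) = 3 * r ^+ 3 * (r - s).
  by field; rewrite !gt_eqF.
have h : r ^+ 2 + r * s + s ^+ 2 <= 3 * r ^+ 2 by nra.
apply: (@le_trans _ _ (r * ((r - s) * (r ^+ 2 + r * s + s ^+ 2)))).
  by rewrite e mulr1.
rewrite (_ : 3 * r ^+ 3 * (r - s) = r * ((r - s) * (3 * r ^+ 2))); last by ring.
apply: ler_wpM2l; first exact: ltW.
by apply: ler_wpM2l => //; rewrite subr_ge0.
Qed.

Lemma cbrt1 : cbrt 1 = 1.
Proof. by rewrite /cbrt powR1. Qed.

(** The indices 0 and 1 have weight 1 each, and the telescoping tail is at most 3. *)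
Lemma sum_weight_le N : \sum_(n < N) weight n <= 5.
Proof.
suff h M : \sum_(n < M.+2) weight n <= 5 - 3 * (cbrt M.+1)^-1.
  case: N => [|[|M]]; first by rewrite big_ord0.
    by rewrite big_ord1 /weight cbrt1 expr1n invr1 ler1n.
  apply: (le_trans (h M)); rewrite gerBl mulr_ge0// invr_ge0 ltW//.
  exact: cbrt_gt0.
elim: M => [|M ih].
  rewrite big_ord_recr/= big_ord1 /weight !cbrt1 expr1n invr1; lra.
rewrite big_ord_recr/=; have := weightS_le (ltn0Sn M); lra.
Qed.

(** With truncated subtraction the index is |j + 1 - i|. Each side of i gives a shifted sum of
    weights, bounded by 5. *)
Lemma sum_weight_dist_le k i : (i <= k.+1)%N ->
  \sum_(j < k) weight ((j.+1 - i) + (i - j.+1)) <= 10.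
Proof.
move=> ik.
have shift N s : \sum_(j < N) weight (s + j) <= 5.
  apply: le_trans (sum_weight_le (s + N)); rewrite big_split_ord/= lerDr.
  by apply: sumr_ge0 => n _; exact: weight_ge0.
pose N := minn i k; have Nk : (N <= k)%N by exact: geq_minr.
have kE : k = (N + (k - N))%N by rewrite subnKC.
rewrite [in leLHS]kE big_split_ord/= (_ : 10 = 5 + 5 :> R); last by ring.
apply: lerD.
  rewrite (reindex_inj rev_ord_inj)/=.
  apply: le_trans (shift N (i - N)%N); apply: ler_sum => j _.
  rewrite le_eqVlt; apply/orP; left; apply/eqP; congr weight.
  have := ltn_ord j; have : (N <= i)%N by exact: geq_minl.
  lia.
apply: le_trans (shift (k - N)%N 1%N); apply: ler_sum => j _.
rewrite le_eqVlt; apply/orP; left; apply/eqP; congr weight.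
by have := ltn_ord j; rewrite /N; lia.
Qed.

(** The hypothesis on L, n and d reads L / d <= A * n^(-2/3). If 2 * L <= d, a positive E is at most
    C * L^2 / D <= 4 * C * (L / d)^2. Otherwise n^(2/3) <= 2 * A, so that 4 * A^2 * [weight n] >= 1
    and E <= C suffices. *)
Lemma mul_weight_le (E D C L d A : R) n : (0 < n)%N ->
  0 < L -> 0 < d -> 0 <= C -> 0 <= A ->
  L ^+ 3 * n%:R ^+ 2 <= A ^+ 3 * d ^+ 3 ->
  E <= C -> E * D <= C * L ^+ 2 -> (2 * L <= d -> (d / 2) ^+ 2 <= D) ->
  E <= 4 * C * A ^+ 2 * weight n.
Proof.
move=> n0 L0 d0 C0 A0 Lnd EC ED dD.
rewrite /weight (maxn_idPl _)//; have r0 := cbrt_gt0 n0.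
move: Lnd; rewrite -(cbrtK n); move: r0; move: (cbrt n) => r r0 Lnd.
have LrA : L * r ^+ 2 <= A * d.
  rewrite -(ler_pXn2r (n := 3)) ?nnegrE//; last 2 first.
  - by rewrite mulr_ge0 ?sqr_ge0// ltW.
  - by rewrite mulr_ge0// ltW.
  by rewrite exprMn -exprM [leRHS]exprMn; move: Lnd; rewrite -exprM.
rewrite ler_pdivlMr ?exprn_gt0//.
have CA0 : 0 <= 4 * C * A ^+ 2 by rewrite !mulr_ge0 ?sqr_ge0.
have [E0|/ltW E0] := leP E 0.
  by apply: le_trans CA0; rewrite mulr_le0_ge0// exprn_ge0// ltW.
have [Ld|dL] := leP (2 * L) d.
  have dd : 0 < d ^+ 2 by rewrite exprn_gt0.
  rewrite -(ler_pM2r dd).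
  apply: (@le_trans _ _ (4 * (E * D) * r ^+ 4)).
    have -> : E * r ^+ 4 * d ^+ 2 = 4 * (E * (d / 2) ^+ 2) * r ^+ 4 by field.
    apply: ler_wpM2r; first by rewrite exprn_ge0// ltW.
    by rewrite ler_pM2l//; apply: ler_wpM2l => //; exact: dD.
  apply: (@le_trans _ _ (4 * (C * L ^+ 2) * r ^+ 4)).
    apply: ler_wpM2r; first by rewrite exprn_ge0// ltW.
    by rewrite ler_pM2l.
  have -> : 4 * (C * L ^+ 2) * r ^+ 4 = 4 * C * (L * r ^+ 2) ^+ 2 by ring.
  have -> : 4 * C * A ^+ 2 * d ^+ 2 = 4 * C * (A * d) ^+ 2 by ring.
  apply: ler_wpM2l; first by rewrite mulr_ge0.
  by rewrite lerXn2r// nnegrE mulr_ge0 ?sqr_ge0// ltW.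
have r2A : r ^+ 2 <= 2 * A by rewrite -(ler_pM2l L0); nra.
have -> : r ^+ 4 = (r ^+ 2) ^+ 2 by rewrite -exprM.
have -> : 4 * C * A ^+ 2 = C * (2 * A) ^+ 2 by ring.
by apply: ler_pM => //; rewrite ?sqr_ge0// lerXn2r// nnegrE ?sqr_ge0// mulr_ge0.
Qed.
End Weights.

(** * The potential as a finite real integral *)

Section RegularMeasure.
Context {R : realType} (mu : probability (measurableTypeR R) R).
Variables (a b K : R).
Hypotheses (ab : a < b) (K0 : 0 <= K).
Hypothesis reg : regular_mass K a b (mass mu).
Hypothesis atomless : forall t : R, mu [set t] = 0%E.
Hypothesis full : mass mu a b = 1.

Lemma cabsE (z : R[i]) (t : R) :
  cabs (z - t%:C) = Num.sqrt (dist2 (complex.Re z) (complex.Im z) t).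
Proof. by case: z => x y; rewrite /cabs /dist2 /= subr0. Qed.

(** The extended integrand and the real one differ only at t = z and outside ]a, b], which is a null
    set. *)
Lemma log_potentialE (z : R[i]) :
  log_potential mu z =
  (- \int[mu]_(t in `]a, b]) ln_dist (complex.Re z) (complex.Im z) t)%:E.
Proof.
set x := complex.Re z; set y := complex.Im z.
have m0 : 0 < mass mu a b by rewrite full.
have ild := integrable_ln_dist K0 reg (lexx a) ab (lexx b) x y.
rewrite /log_potential.
pose G : R -> \bar R := (fun t => (- ln_dist x y t)%:E) \_ `]a, b].
pose F (t : R) := if Num.sqrt (dist2 x y t) == 0 then +oo%E else (- ln_dist x y t)%:E.
have FE : (fun t : R => lne ((cabs (z - t%:C))%:E^-1)) = F.
  apply/funext => t; rewrite cabsE -/x -/y /F inver.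
  case: eqVneq => // d0.
  have dp : 0 < Num.sqrt (dist2 x y t) by rewrite lt_neqAle eq_sym d0 sqrtr_ge0.
  by rewrite lne_EFin ?invr_gt0// lnV.
have mG : measurable_fun setT G.
  apply/(measurable_restrictT _ _).1 => //; apply/measurable_EFinP.
  by apply: measurableT_comp => //; apply: measurable_funTS; exact: measurable_ln_dist.
have mF : measurable_fun setT F.
  apply: measurable_fun_ifT => //.
    apply: (@measurable_fun_eqr _ _ R) => //; exact: measurable_sqrt_dist2.
  apply/measurable_EFinP; apply: measurableT_comp => //; exact: measurable_ln_dist.
have FG : ae_eq mu setT F G.
  exists (~` `]a, b] `|` [set x]); split.
  - by apply: measurableU => //; exact: measurableC.
  - apply/eqP; rewrite -measure_le0.
    apply: (@le_trans _ _ (mu (~` `]a, b]%classic) + mu [set x])%E).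
      by apply: measureU2 => //; exact: measurableC.
    by rewrite atomless adde0 probability_setC// massE full subee.
  - move=> t /=; apply: contra_notP => /not_orP[/contrapT tI tx] _.
    rewrite /F /G patchE mem_set//; case: eqVneq => // /eqP.
    rewrite sqrtr_eq0 /dist2 => h; exfalso; apply: tx; apply/eqP.
    rewrite eq_sym -subr_eq0 -sqrf_eq0 eq_le sqr_ge0 andbT.
    by apply: le_trans h; rewrite lerDl sqr_ge0.
rewrite FE (@ae_eq_integral _ _ _ mu setT G F)// -integral_mkcond.
under eq_integral do rewrite -mulN1r EFinM.
have IE : (\int[mu]_(t in `]a, b]) (ln_dist x y t)%:E =
    (\int[mu]_(t in `]a, b]) ln_dist x y t)%:E)%E.
  by rewrite fineK//; exact: integrable_fin_num.
by rewrite integralZl// IE -EFinM mulN1r.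
Qed.

Lemma Rintegral_subdivision (tau : nat -> R) k f :
  (forall j, (j < k)%N -> tau j < tau j.+1) ->
  mu.-integrable `]tau 0%N, tau k] (EFin \o f) ->
  \int[mu]_(t in `]tau 0%N, tau k]) f t =
  \sum_(j < k) \int[mu]_(t in `]tau j, tau j.+1]) f t.
Proof.
elim: k => [|k ih] tauS intf.
  by rewrite big_ord0 set_itv_ge ?Rintegral_set0// bnd_simp ltxx.
have t0k n : (n <= k)%N -> tau 0%N <= tau n.
  elim: n => // n ihn nk; apply: (le_trans (ihn (ltnW nk))).
  by apply/ltW/tauS/ltnW.
have E : `]tau 0%N, tau k.+1]%classic = `]tau 0%N, tau k] `|` `]tau k, tau k.+1].
  by rewrite -itv_bndbnd_setU ?bnd_simp ?t0k// ltW// tauS.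
rewrite E in intf *; rewrite Rintegral_setU//; last first.
  rewrite disj_set2E; apply/eqP/seteqP; split => // t [/=]; rewrite !in_itv/=.
  by move=> /andP[_ tr] /andP[/(le_lt_trans tr)]; rewrite ltxx.
rewrite big_ord_recr/= ih//.
- by move=> j jk; apply: tauS; exact: ltnW.
- by apply: integrableS intf => //; exact: measurableU.
Qed.

End RegularMeasure.

(** * The polynomial with zeros at the barycenters *)

Section Discretization.
Context {R : realType} (mu : probability (measurableTypeR R) R).
Variables (a b K : R).
Hypotheses (ab : a < b) (K0 : 0 <= K).
Hypothesis reg : regular_mass K a b (mass mu).
Hypothesis atomless : forall t : R, mu [set t] = 0%E.
Hypothesis full : mass mu a b = 1.

(** The bound of [mul_weight_le] with A = K + 1, times the sum 10 of the weights. *)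
Definition discretization_cst : R := 4 * piece_cst K * (K + 1) ^+ 2 * 10.

Lemma prod_gt0_ln (I : Type) (r : seq I) (f : I -> R) : (forall i, 0 < f i) ->
  0 < \prod_(i <- r) f i /\ ln (\prod_(i <- r) f i) = \sum_(i <- r) ln (f i).
Proof.
move=> f0; elim: r => [|i r [p0 ih]]; first by rewrite !big_nil ln1.
by rewrite !big_cons mulr_gt0// lnM ?posrE// ih.
Qed.

Section Subdivision.
Variables (k : nat) (tau : nat -> R).
Hypotheses (k0 : (0 < k)%N) (tau0 : tau 0%N = a) (tauk : tau k = b).
Hypothesis tau_lt : forall i j, (i < j)%N -> (j <= k)%N ->
  tau i < tau j /\ mass mu (tau i) (tau j) = (j - i)%:R / k%:R.

Let c j := barycenter mu (tau j) (tau j.+1).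

Let tau_le i j : (i <= j)%N -> (j <= k)%N -> tau i <= tau j.
Proof.
rewrite leq_eqVlt => /predU1P[->//|ij jk].
by have [/ltW] := tau_lt ij jk.
Qed.

Let tau_ge i : (i <= k)%N -> a <= tau i.
Proof. by rewrite -tau0; apply: tau_le. Qed.

Let tau_leb i : (i <= k)%N -> tau i <= b.
Proof. by rewrite -tauk => ik; apply: tau_le. Qed.

Let piece j : (j < k)%N ->
  [/\ a <= tau j, tau j < tau j.+1, tau j.+1 <= b &
      mass mu (tau j) (tau j.+1) = k%:R^-1].
Proof.
move=> jk; have [lt m] := tau_lt (ltnSn j) jk.
split => //; [exact/tau_ge/ltnW|exact: tau_leb|by rewrite m subSnn mul1r].
Qed.

Let kR : 0 < k%:R :> R. Proof. by rewrite ltr0n. Qed.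

(** The share of the j-th interval in log |P| + k * U; the factor k normalizes its mass 1/k. *)
Definition piece_error (x y : R) (j : nat) : R :=
  ln_dist x y (c j) - k%:R * \int[mu]_(t in `]tau j, tau j.+1]) ln_dist x y t.

Lemma subdivision_barycenter_itv j : (j < k)%N ->
  tau j < barycenter mu (tau j) (tau j.+1) < tau j.+1.
Proof.
move=> jk; have [aj lt jb m] := piece jk.
by apply: (barycenter_itv reg aj lt jb); rewrite m invr_gt0.
Qed.

(** The lower half of regularity for masses 1/k and (r - i)/k, where k cancels. Weakening K to (K +
    1)^3 prepares the cube root taken in [mul_weight_le]. *)
Let gap_le i j r : (i <= j)%N -> (j < r)%N -> (r <= k)%N ->
  (tau j.+1 - tau j) ^+ 3 * (r - i)%:R ^+ 2 <=
  (K + 1) ^+ 3 * (tau r - tau i) ^+ 3.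
Proof.
move=> ij jr rk; have ir := leq_ltn_trans ij jr.
have lk := leq_trans jr rk; have ik := leq_trans (ltnW ir) rk.
have [h _] := reg (tau_ge ik) (tau_le ij (ltnW lk)) (tau_le (leqnSn j) lk)
  (tau_le jr rk) (tau_leb rk).
have [_ mir] := tau_lt ir rk; have [_ mj] := tau_lt (ltnSn j) lk.
move: h; rewrite mir mj subSnn !expr_div_n expr1n.
have kk : 0 < k%:R ^+ 2 :> R by rewrite exprn_gt0.
rewrite -(ler_pM2r kk) => h.
have -> : (tau j.+1 - tau j) ^+ 3 * (r - i)%:R ^+ 2 =
  (tau j.+1 - tau j) ^+ 3 * ((r - i)%:R ^+ 2 / k%:R ^+ 2) * k%:R ^+ 2.
  by field; rewrite gt_eqF.
apply: (le_trans h).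
have -> : K * (1 / k%:R ^+ 2) * (tau r - tau i) ^+ 3 * k%:R ^+ 2 =
  K * (tau r - tau i) ^+ 3 by field; rewrite gt_eqF.
apply: ler_wpM2r; first by rewrite exprn_ge0// subr_ge0 tau_le// ltnW.
have : 0 <= K ^+ 3 by rewrite exprn_ge0.
have : 0 <= K ^+ 2 by rewrite exprn_ge0.
have := K0; nra.
Qed.

Lemma piece_error_le x y j : (j < k)%N -> 0 < dist2 x y (c j) ->
  piece_error x y j <= piece_cst K /\
  piece_error x y j * dist2 x y (c j) <= piece_cst K * (tau j.+1 - tau j) ^+ 2.
Proof.
move=> jk D0; have [aj lt jb m] := piece jk.
have m0 : 0 < mass mu (tau j) (tau j.+1) by rewrite m invr_gt0.
have [] := ln_dist_integral_le K0 reg aj lt jb m0 D0.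
rewrite -/(c j) m -(ler_pM2r kR) => h1; rewrite -(ler_pM2r kR) => h2.
have kV : k%:R != 0 :> R by rewrite gt_eqF.
have E : piece_error x y j = (ln_dist x y (c j) * k%:R^-1 -
    \int[mu]_(t in `]tau j, tau j.+1]) ln_dist x y t) * k%:R.
  by rewrite /piece_error; field.
split; first by rewrite E; apply: (le_trans h1); rewrite mulfVK.
rewrite E mulrAC; apply: (le_trans h2); by rewrite mulfVK.
Qed.

Lemma sum_piece_error_le x y : (forall j, (j < k)%N -> 0 < dist2 x y (c j)) ->
  \sum_(j < k) piece_error x y j <= discretization_cst.
Proof.
move=> D0; have C0 := piece_cst_ge0 K.
have A0 : 0 <= K + 1 by rewrite addr_ge0.
(* The least such i is the index of the first node at or right of x, with k + 1 standing for x > b.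
   If 0 < i <= k, the interval of index i - 1 contains x. *)
have ex : exists i, (k < i)%N || (x <= tau i) by exists k.+1; rewrite ltnSn.
have [i hi mini] := ex_minnP ex.
have ik : (i <= k.+1)%N by apply: mini; rewrite ltnSn.
have CA0 : 0 <= 4 * piece_cst K * (K + 1) ^+ 2 by rewrite !mulr_ge0 ?sqr_ge0.
apply: (@le_trans _ _ (\sum_(j < k) 4 * piece_cst K * (K + 1) ^+ 2 *
    weight ((j.+1 - i) + (i - j.+1)))); last first.
  by rewrite -mulr_sumr; apply: ler_wpM2l => //; exact: sum_weight_dist_le.
apply: ler_sum => -[j jk] _ /=.
have [e1 e2] := piece_error_le jk (D0 _ jk).
have /andP[jc cj] : tau j < c j < tau j.+1 := subdivision_barycenter_itv jk.
have xcD : (x - c j) ^+ 2 <= dist2 x y (c j) by rewrite lerDl sqr_ge0.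
have [ltj _] := tau_lt (ltnSn j) jk.
(* The j-th interval lies right of x, left of x, or has index i - 1. In the first two cases d runs
   from the node next to x to the far end of the interval, so |x - c j| >= d - L >= d / 2 once 2 * L
   <= d. *)
have [ij|ji|ij] := ltngtP i j.+1.
- have xi : x <= tau i by move: hi; rewrite ltnNge (ltnW (leq_trans ij jk)).
  have -> : (i - j.+1 = 0)%N by apply/eqP; rewrite subn_eq0 ltnW.
  rewrite addn0.
  have [lti _] := tau_lt ij jk.
  apply: (mul_weight_le (d := tau j.+1 - tau i) _ _ _ C0 A0 _ e1 e2).
  - by rewrite subn_gt0.
  - by rewrite subr_gt0.
  - by rewrite subr_gt0.
  - exact: gap_le.
  move=> Ld; apply: le_trans xcD.
  rewrite (_ : (x - c j) ^+ 2 = (c j - x) ^+ 2); last by ring.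
  by rewrite lerXn2r ?nnegrE//; lra.
- have il : (i.-1 <= k)%N by rewrite -ltnS (ltn_predK ji).
  have xi : tau i.-1 < x.
    rewrite ltNge; apply/negP => xi; have := mini i.-1; rewrite xi orbT.
    by move=> /(_ isT); rewrite -ltnS (ltn_predK ji) ltnn.
  have -> : (j.+1 - i = 0)%N by apply/eqP; rewrite subn_eq0 ltnW.
  have ji' : (j < i.-1)%N by rewrite -ltnS (ltn_predK ji).
  have -> : (0 + (i - j.+1) = i.-1 - j)%N by rewrite add0n -{1}(ltn_predK ji) subSS.
  have [lti _] := tau_lt ji' il.
  apply: (mul_weight_le (d := tau i.-1 - tau j) _ _ _ C0 A0 _ e1 e2).
  - by rewrite subn_gt0.
  - by rewrite subr_gt0.
  - by rewrite subr_gt0.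
  - exact: gap_le.
  move=> Ld; apply: le_trans xcD.
  by rewrite lerXn2r ?nnegrE//; lra.
rewrite ij subnn /weight /= cbrt1 expr1n invr1 mulr1.
apply: (le_trans e1).
have : 1 <= (K + 1) ^+ 2 by rewrite exprn_ege1// lerDr.
by nra.
Qed.

Lemma piece_error_ge0 x j : (j < k)%N -> x \notin `]a, b[ -> 0 <= piece_error x 0 j.
Proof.
move=> jk xab; have [aj lt jb m] := piece jk.
have m0 : 0 < mass mu (tau j) (tau j.+1) by rewrite m invr_gt0.
have xj : (x <= tau j) || (tau j.+1 <= x).
  move: xab; rewrite in_itv/= negb_and -!leNgt => /orP[xa|bx].
    by rewrite (le_trans xa).
  by rewrite (le_trans jb)// orbT.
have := ln_dist_integral_ge K0 reg atomless aj lt jb m0 xj.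
rewrite -/(c j) m ler_pdivlMr// => h.
by rewrite /piece_error subr_ge0 mulrC.
Qed.

Lemma sum_piece_error x y : \sum_(j < k) piece_error x y j =
  \sum_(j < k) ln_dist x y (c j) - k%:R * \int[mu]_(t in `]a, b]) ln_dist x y t.
Proof.
rewrite sumrB -mulr_sumr -tau0 -tauk -Rintegral_subdivision//.
  by move=> j jk; have [] := tau_lt (ltnSn j) jk.
by rewrite tau0 tauk; apply: (integrable_ln_dist K0 reg).
Qed.

Definition discretization : {poly R[i]} := \prod_(j < k) ('X - ((c j)%:C)%:P).

Lemma monic_discretization : discretization \is monic.
Proof. by rewrite /discretization; apply: monic_prod_XsubC. Qed.

Lemma size_discretization : size discretization = k.+1.
Proof.
rewrite /discretization size_prod_XsubC /index_enum; case: index_enum_key => /=.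
by rewrite -enumT size_enum_ord.
Qed.

Lemma cabs_discretization (z : R[i]) : cabs discretization.[z] =
  \prod_(j < k) Num.sqrt (dist2 (complex.Re z) (complex.Im z) (c j)).
Proof.
rewrite /discretization horner_prod.
rewrite (big_morph (@cabs R) (@ComplexField.Normc.normcM R) (@ComplexField.Normc.normc1 R)).
by apply: eq_bigr => j _; rewrite hornerXsubC cabsE.
Qed.

Lemma discretization_log_potential (z : R[i]) :
  (forall j, (j < k)%N -> 0 < dist2 (complex.Re z) (complex.Im z) (c j)) ->
  (lne (cabs discretization.[z])%:E + k%:R%:E * log_potential mu z)%E =
  (\sum_(j < k) piece_error (complex.Re z) (complex.Im z) j)%:E.
Proof.
move=> D0; rewrite cabs_discretization (log_potentialE ab K0 reg atomless full).
set x := complex.Re z; set y := complex.Im z.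
have [|p0 lnp] := @prod_gt0_ln _ (index_enum 'I_k)
  (fun j => Num.sqrt (dist2 x y (c j))).
  by move=> j; rewrite sqrtr_gt0 D0.
by rewrite lne_EFin// lnp sum_piece_error -EFinM -EFinD mulrN.
Qed.
End Subdivision.

Lemma log_discretization_bounds k : (0 < k)%N ->
  exists P : {poly R[i]},
    [/\ P \is monic,
        size P = k.+1,
        forall z : R[i],
          (lne (cabs P.[z])%:E + k%:R%:E * log_potential mu z
             <= discretization_cst%:E)%E
      & forall x : R, x \notin `]a, b[ ->
          (0 <= lne (cabs P.[x%:C])%:E + k%:R%:E * log_potential mu x%:C)%E].
Proof.
move=> k0; have [tau [tau0 tauk tau_lt]] := equal_mass_subdivision ab K0 reg full k0.
exists (discretization k tau); split.
- exact: monic_discretization.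
- exact: size_discretization.
- move=> z; set x := complex.Re z; set y := complex.Im z.
  pose c j := barycenter mu (tau j) (tau j.+1).
  (* A zero of P is treated apart: there log |P| is minus infinity and the potential is finite. *)
  have [D0|] := pselect (forall j, (j < k)%N -> 0 < dist2 x y (c j)).
    rewrite discretization_log_potential// lee_fin.
    exact: sum_piece_error_le.
  move=> /existsNP[j /not_implyP[jk /negP]]; rewrite -leNgt => D0.
  rewrite cabs_discretization (bigD1 (Ordinal jk))//=.
  rewrite -/x -/y -/(c j) (_ : Num.sqrt _ = 0) ?mul0r; last first.
    by apply/eqP; rewrite sqrtr_eq0.
  by rewrite (log_potentialE ab K0 reg atomless full) -EFinM /= lexx leNye.
- move=> x xab.
  (* The barycenters lie strictly inside (a, b), so x is not a zero. *)
  have D0 j : (j < k)%N -> 0 < dist2 x 0 (barycenter mu (tau j) (tau j.+1)).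
    move=> jk; have jk' := ltnW jk.
    have /andP[jc cj] := subdivision_barycenter_itv k0 tau0 tauk tau_lt jk.
    have le_tau i l : (i <= l)%N -> (l <= k)%N -> tau i <= tau l.
      rewrite leq_eqVlt => /predU1P[->//|il lk].
      by have [/ltW] := tau_lt _ _ il lk.
    have aj := le_tau 0%N j (leq0n _) jk'; have jb := le_tau _ _ jk (leqnn k).
    rewrite tau0 in aj; rewrite tauk in jb.
    rewrite /dist2 expr0n/= addr0 lt_neqAle sqr_ge0 andbT eq_sym sqrf_eq0 subr_eq0.
    by apply: contraNneq xab => ->; rewrite in_itv/=; lra.
  rewrite discretization_log_potential//= lee_fin.
  by apply: sumr_ge0 => j _; exact: piece_error_ge0.
Qed.
End Discretization.

Theorem theorem2p1 (R : realType) :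
  exists C_BW : R,
  forall (a b : R) (mu : probability (measurableTypeR R) R) (g : R -> R),
    a < b ->
    mu [set` `[a, b]] = 1%E ->
    has_density_on mu a b
      (fun t => g t / (pi * Num.sqrt ((t - a) * (b - t)))) ->
    {in `]a, b[, forall t, 0 <= g t} ->
    concave_function [set` `]a, b[] g ->
    {in `]a, b[ &, {homo g : s t / s <= t}} ->
    convex_function (E := R^o) [set` `]a, b[] (fun t => g t / (t - a)) ->
    forall k : nat, (2 <= k)%N ->
    exists P : {poly R[i]},
      [/\ P \is monic,
          size P = k.+1,
          forall z : R[i],
            (lne (cabs P.[z])%:E + k%:R%:E * log_potential mu z <= C_BW%:E)%E
        & forall x : R, x \notin `]a, b[ ->
            (0 <= lne (cabs P.[x%:C])%:E
                  + k%:R%:E * log_potential mu x%:C)%E].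
Proof.
exists (discretization_cst (128 * 16 ^+ 2)) => a b mu g ab muab mud g0 cg gnd _ k k2.
have atomless := density_set1 mud.
(* The endpoint a has no mass, so passing from [a, b] to ]a, b] loses nothing. *)
have full : mass mu a b = 1.
  apply: EFin_inj; rewrite -massE -muab -(setU1itv false) ?bnd_simp 1?ltW//.
  have d : [set a] `&` `]a, b]%classic = set0.
    by apply/seteqP; split => // t [/= ->]; rewrite in_itv/= ltxx.
  by rewrite measureU// [X in (X + _)%E](atomless a) add0e.
apply: (log_discretization_bounds ab _ _ atomless full).
- by rewrite mulr_ge0// sqr_ge0.
- exact: arcsine_density_regular mud g0 cg gnd.
- exact: ltnW.
Qed.
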